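(* Let $d\geq 2$ and let $(a_n)_{n\geq1}$ satisfy $0<a_{n+1}\leq a_n<1$ for all $n\geq1$. For each $n\geq 1$ let \[ F_n(z,w)=\big(z^d+q_n(z)+\delta_n w,\ \delta_n z\big), \] where $\delta_n\neq 0$, $q_n$ is a polynomial with $1\leq\deg q_n\leq d-1$, and the moduli of all coefficients of $q_n$ and $|\delta_n|$ are bounded by $a_n^{d^n}$. Then the non-autonomous basin of attraction \[ \Omega=\{(z,w)\in\mathbb{C}^2: F_n\circ\cdots\circ F_1(z,w)\to 0 \text{ as } n\to\infty\} \] is a Loewner Short $\mathbb{C}^2$.
   Context: Definition (Short $\mathbb{C}^k$): for $k\geq 2$, a domain $\Omega\subseteq\mathbb{C}^k$ is a Short $\mathbb{C}^k$ if it is the union of an increasing sequence of domains each biholomorphic to the unit ball of $\mathbb{C}^k$, its Kobayashi–Royden infinitesimal pseudometric vanishes identically, and it carries a non-constant plurisubharmonic function bounded above. Definition (Loewner): a Short $\mathbb{C}^k$ $\Omega$ is Loewner if there is a family of domains $\{\Omega_t\}_{t\geq0}$ with: (1) $\Omega=\bigcup_{t\geq0}\Omega_t$, and either every $\Omega_t$ is biholomorphic to the unit ball of $\mathbb{C}^k$ or every $\Omega_t$ is biholomorphic to the unit polydisc of $\mathbb{C}^k$; (2) $\Omega_t\subset\subset\Omega_s$ whenever $0\leq t<s$; (3) $\Omega_t=\bigcup_{t'<t}\Omega_{t'}$ for all $t>0$; (4) $\overline{\Omega_{t'}}=\bigcap_{t>t'}\Omega_t$ for all $t'\geq 0$. 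*)

(* Defs.v *)
From HB Require Import structures.
From mathcomp Require Import all_boot all_order all_algebra.
From mathcomp Require Import all_classical all_reals all_analysis.
From mathcomp Require Import complex.

Set Implicit Arguments.
Unset Strict Implicit.
Unset Printing Implicit Defensive.

Import Order.TTheory GRing.Theory Num.Theory ComplexField numFieldNormedType.Exports.
Local Open Scope ring_scope.
Local Open Scope classical_set_scope.

Section C2defs.
Variable R : realType.

Local Notation C := (R[i]).
Definition C2 := (C * C)%type.

Definition cabs (z : C) : R := Num.sqrt (complex.Re z ^+ 2 + complex.Im z ^+ 2).

Definition addC2 (p q : C2) : C2 := (p.1 + q.1, p.2 + q.2).
Definition subC2 (p q : C2) : C2 := (p.1 - q.1, p.2 - q.2).
Definition sclC2 (a : C) (p : C2) : C2 := (a * p.1, a * p.2).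
Definition zeroC2 : C2 := (0, 0).

Definition normC2 (p : C2) : R := Num.sqrt (cabs p.1 ^+ 2 + cabs p.2 ^+ 2).

Definition unit_ball : set C2 := [set p | normC2 p < 1].
Definition unit_polydisc : set C2 := [set p | cabs p.1 < 1 /\ cabs p.2 < 1].

Definition openC2 (U : set C2) : Prop :=
  forall p, U p -> exists2 r : R, 0 < r & forall q, normC2 (subC2 q p) < r -> U q.

Definition closureC2 (A : set C2) : set C2 :=
  [set p | forall e : R, 0 < e -> exists2 q, A q & normC2 (subC2 q p) < e].

Definition compactC2 (K : set C2) : Prop :=
  forall (I : Type) (G : I -> set C2),
    (forall i, openC2 (G i)) -> K `<=` \bigcup_i G i ->
    exists2 D : set I, finite_set D & K `<=` \bigcup_(i in D) G i.

Definition connectedC2 (U : set C2) : Prop :=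
  forall A B : set C2, openC2 A -> openC2 B -> U `<=` A `|` B ->
    U `&` A `&` B = set0 -> U `&` A = set0 \/ U `&` B = set0.

Definition domainC2 (U : set C2) : Prop :=
  U !=set0 /\ openC2 U /\ connectedC2 U.

Definition relcompactC2 (A B : set C2) : Prop :=
  compactC2 (closureC2 A) /\ closureC2 A `<=` B.

(* holomorphic maps U -> C^2 on an open set U of C^2: complex (Fréchet)
   differentiability at each point, the differential being C-linear,
   h |-> h.1 * c1 + h.2 * c2 *)
Definition holomorphicC2 (U : set C2) (F : C2 -> C2) : Prop :=
  forall p, U p -> exists c1 c2 : C2,
    forall e : R, 0 < e -> exists2 dl : R, 0 < dl &
      forall h : C2, normC2 h < dl ->
        normC2 (subC2 (subC2 (F (addC2 p h)) (F p))
                      (addC2 (sclC2 h.1 c1) (sclC2 h.2 c2))) <= e * normC2 h.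

Definition biholomorphicC2 (U V : set C2) : Prop :=
  exists f g : C2 -> C2,
    [/\ holomorphicC2 U f, holomorphicC2 V g,
        (forall p, U p -> V (f p) /\ g (f p) = p) &
        (forall q, V q -> U (g q) /\ f (g q) = q)].

Definition cderiv (phi : C -> C2) (z : C) (v : C2) : Prop :=
  forall e : R, 0 < e -> exists2 dl : R, 0 < dl &
    forall h : C, cabs h < dl ->
      normC2 (subC2 (subC2 (phi (z + h)) (phi z)) (sclC2 h v)) <= e * cabs h.

Definition holo_disc (Omega : set C2) (phi : C -> C2) : Prop :=
  (forall z, cabs z < 1 -> exists v, cderiv phi z v) /\
  (forall z, cabs z < 1 -> Omega (phi z)).

Definition kobayashi_royden (Omega : set C2) (p v : C2) : \bar R :=
  ereal_inf [set ((r^-1)%:E)%E | r in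
    [set r : R | 0 < r /\ exists phi, holo_disc Omega phi /\ phi 0 = p /\
                 cderiv phi 0 (sclC2 (r +i* 0)%C v)]].

Definition expi (t : R) : C := (cos t +i* sin t)%C.

Definition plurisubharmonic (Omega : set C2) (u : C2 -> \bar R) : Prop :=
  [/\ (forall p, Omega p -> (u p < +oo)%E),
      (forall p (c : R), Omega p -> (u p < c%:E)%E ->
         exists2 dl : R, 0 < dl & forall q, Omega q -> normC2 (subC2 q p) < dl ->
           (u q < c%:E)%E) &
      (forall a b : C2, Omega a ->
         (forall zeta : C, cabs zeta <= 1 -> Omega (addC2 a (sclC2 zeta b))) ->
         (u a <= ((2 * pi)^-1 : R)%R%:E *
            \int[@lebesgue_measure R]_(t in `[0%R, (2 * pi)%R]) u (addC2 a (sclC2 (expi t) b)))%E)].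

Definition shortC2 (Omega : set C2) : Prop :=
  [/\ domainC2 Omega,
      (exists W : nat -> set C2,
         [/\ forall n, W n `<=` W n.+1,
             Omega = \bigcup_n W n &
             forall n, domainC2 (W n) /\ biholomorphicC2 (W n) unit_ball]),
      (forall p v, Omega p -> kobayashi_royden Omega p v = 0%E) &
      (exists u : C2 -> \bar R,
         [/\ plurisubharmonic Omega u,
             (exists M : R, forall p, Omega p -> (u p <= M%:E)%E) &
             (exists p q, Omega p /\ Omega q /\ u p <> u q)])].

Definition loewner_shortC2 (Omega : set C2) : Prop :=
  shortC2 Omega /\
  exists W : R -> set C2,
    (forall t, 0 <= t -> domainC2 (W t)) /\
    [/\ Omega = \bigcup_(t in [set t : R | 0 <= t]) W t,
        ((forall t, 0 <= t -> biholomorphicC2 (W t) unit_ball) \/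
         (forall t, 0 <= t -> biholomorphicC2 (W t) unit_polydisc)),
        (forall t s, 0 <= t -> t < s -> relcompactC2 (W t) (W s)),
        (forall t, 0 < t -> W t = \bigcup_(t' in [set t' : R | 0 <= t' < t]) W t') &
        (forall t', 0 <= t' -> closureC2 (W t') = \bigcap_(t in [set t : R | t' < t]) W t)].

Definition Fmap (d : nat) (q : {poly C}) (delta : C) (p : C2) : C2 :=
  (p.1 ^+ d + q.[p.1] + delta * p.2, delta * p.1).

Fixpoint compF (F : nat -> C2 -> C2) (n : nat) (p : C2) : C2 :=
  match n with
  | 0 => p
  | m.+1 => F m.+1 (compF F m p)
  end.

Definition basin (F : nat -> C2 -> C2) : set C2 :=
  [set p | (fun n => normC2 (compF F n p)) @ \oo --> (0 : R)].

End C2defs.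

(* Main.v *)
(* Put e_n = a_1^(d^n) and G_n = F_n o ... o F_1.  In the sup norm
   |F_n p| <= |p|^d + (d+1) e_n for |p| <= 1, so for n >= n0 the map F_(n+1)
   sends the polydisc (and the ball) of radius 1/8 into itself, and the basin is
   the increasing union of the sets |G_n| < 1/8.

   - Kobayashi metric: along an orbit tending to 0 the differentials DG_n(p)
     tend to 0, so the pull-backs under G_n of affine discs of radius 1/16 have
     arbitrarily large derivative at p.
   - Plurisubharmonic function: with B = d+2, the functions
     K_n = d^-n ln (B max(|G_n|, e_n)) are eventually decreasing on the basin,
     because B max(|G_(n+1)|, e_(n+1)) <= (B max(|G_n|, e_n))^d.  The limit is
     bounded, and it is non-constant since z^d dominates along an orbit starting
     at G_n0^-1(1/16, 0).  The sub-mean value property of ln max(|g|, c) for a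
     polynomial g follows from the maximum principle applied to the product of
     the rotates of g by the N-th roots of unity, as N tends to infinity.
   - Loewner chain: in the coordinates (z, w) = G_n(p), the polydisc of radius
     1/8 is joined to the preimage under F_(n+1) of the polydisc of radius 1/8 by
     the domains |z| < s, |delta w + c (z^d + q(z))| < r with c going from 0 to 1
     and s, r increasing; each of them is the image of a polydisc under a
     polynomial automorphism. *)

Require Import Defs.
From HB Require Import structures.
From mathcomp Require Import all_boot all_order all_algebra.
From mathcomp Require Import all_classical all_reals all_analysis.
From mathcomp Require Import complex ring lra zify finmap.
Set Implicit Arguments.
Unset Strict Implicit.
Unset Printing Implicit Defensive.
Import Order.TTheory GRing.Theory Num.Theory ComplexField numFieldNormedType.Exports.
Local Open Scope ring_scope.
Local Open Scope classical_set_scope.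

(** * Norms *)

Section Norms.
Variable R : realType.
Local Notation C := (R[i]).
Implicit Types (z w : C) (p q h : C2 R).

Lemma cabsE z : cabs z = Normc.normc z.
Proof. by case: z. Qed.

Lemma cabs_ge0 z : 0 <= cabs z.
Proof. exact: sqrtr_ge0. Qed.

Lemma cabs0 : cabs (0 : C) = 0.
Proof. by rewrite cabsE Normc.normc0. Qed.

Lemma cabs1 : cabs (1 : C) = 1.
Proof. by rewrite cabsE Normc.normc1. Qed.

Lemma cabsM z w : cabs (z * w) = cabs z * cabs w.
Proof. by rewrite !cabsE Normc.normcM. Qed.

Lemma cabsV z : cabs z^-1 = (cabs z)^-1.
Proof. by rewrite !cabsE Normc.normcV. Qed.

Lemma cabsN z : cabs (- z) = cabs z.
Proof. by rewrite -mulN1r cabsM cabsE /= oppr0 expr0n /= addr0 sqrrN expr1n sqrtr1 mul1r. Qed.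

Lemma cabsX z n : cabs (z ^+ n) = cabs z ^+ n.
Proof. by elim: n => [|n IH]; rewrite ?expr0 ?cabs1 // !exprS cabsM IH. Qed.

Lemma cabsD z w : cabs (z + w) <= cabs z + cabs w.
Proof. by rewrite !cabsE; exact: le_normcD. Qed.

Lemma cabsB z w : cabs (z - w) <= cabs z + cabs w.
Proof. by rewrite -(cabsN w); exact: cabsD. Qed.

Lemma cabs_eq0 z : (cabs z == 0) = (z == 0).
Proof.
apply/eqP/eqP => [|->]; last exact: cabs0.
by rewrite cabsE => /Normc.eq0_normc.
Qed.

Lemma cabs_gt0 z : (0 < cabs z) = (z != 0).
Proof. by rewrite lt_def cabs_ge0 andbT cabs_eq0. Qed.

Lemma cabs_real (x : R) : cabs (x%:C)%C = `|x|.
Proof. by rewrite /cabs /= expr0n /= addr0 sqrtr_sqr. Qed.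

Lemma complexReM z w : complex.Re (z * w) =
  complex.Re z * complex.Re w - complex.Im z * complex.Im w.
Proof. by case: z => a b; case: w. Qed.

Lemma complexImM z w : complex.Im (z * w) =
  complex.Re z * complex.Im w + complex.Im z * complex.Re w.
Proof. by case: z => a b; case: w. Qed.

Lemma complexReD z w : complex.Re (z + w) = complex.Re z + complex.Re w.
Proof. by case: z => a b; case: w. Qed.

Lemma complexImD z w : complex.Im (z + w) = complex.Im z + complex.Im w.
Proof. by case: z => a b; case: w. Qed.

Lemma cabs_sqr z : cabs z ^+ 2 = complex.Re z ^+ 2 + complex.Im z ^+ 2.
Proof. by rewrite sqr_sqrtr // addr_ge0 ?sqr_ge0. Qed.

Lemma cabs_Re z : `|complex.Re z| <= cabs z.
Proof.
rewrite -sqrtr_sqr ler_sqrt ?lerDl ?sqr_ge0 //.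
by rewrite addr_ge0 ?sqr_ge0.
Qed.

Lemma cabs_Im z : `|complex.Im z| <= cabs z.
Proof.
rewrite -sqrtr_sqr ler_sqrt ?lerDr ?sqr_ge0 //.
by rewrite addr_ge0 ?sqr_ge0.
Qed.

Lemma cabs_le_ReIm z : cabs z <= `|complex.Re z| + `|complex.Im z|.
Proof.
rewrite -(ler_sqr (cabs_ge0 z)) ?nnegrE ?addr_ge0 //; last first.
rewrite cabs_sqr sqrrD !real_normK ?num_real // -addrA lerD2l lerDr.
by rewrite mulrn_wge0 // mulr_ge0.
Qed.

Lemma cabs_sum (I : Type) (s : seq I) (f : I -> C) :
  cabs (\sum_(i <- s) f i) <= \sum_(i <- s) cabs (f i).
Proof.
elim/big_ind2: _ => [|x a y b hx hy|//]; first by rewrite cabs0.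
by apply: le_trans (cabsD _ _) _; rewrite lerD.
Qed.

Lemma cabs_expi (t : R) : cabs (expi t) = 1.
Proof. by rewrite /cabs /= cos2Dsin2 sqrtr1. Qed.

(** The sup norm turns estimates on polydiscs and on F_n into coordinatewise ones; [nrm_normC2] and
    [normC2_nrm] compare it with the Euclidean norm. *)
Definition nrm p : R := Num.max (cabs p.1) (cabs p.2).

Lemma nrm_ge0 p : 0 <= nrm p.
Proof. by rewrite le_max cabs_ge0. Qed.

Lemma nrm_fst p : cabs p.1 <= nrm p.
Proof. by rewrite le_max lexx. Qed.

Lemma nrm_snd p : cabs p.2 <= nrm p.
Proof. by rewrite le_max lexx orbT. Qed.

Lemma nrm_lt p (r : R) : nrm p < r <-> cabs p.1 < r /\ cabs p.2 < r.
Proof. by rewrite gt_max; split => /andP. Qed.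

Lemma nrm_le p (r : R) : nrm p <= r <-> cabs p.1 <= r /\ cabs p.2 <= r.
Proof. by rewrite ge_max; split => /andP. Qed.

Lemma normC2_ge0 p : 0 <= normC2 p.
Proof. exact: sqrtr_ge0. Qed.

Lemma normC2_sqr p : normC2 p ^+ 2 = cabs p.1 ^+ 2 + cabs p.2 ^+ 2.
Proof. by rewrite sqr_sqrtr // addr_ge0 ?sqr_ge0. Qed.

Lemma normC2_fst p : cabs p.1 <= normC2 p.
Proof. by rewrite -ler_sqr ?nnegrE ?cabs_ge0 ?normC2_ge0 // normC2_sqr lerDl sqr_ge0. Qed.

Lemma normC2_snd p : cabs p.2 <= normC2 p.
Proof. by rewrite -ler_sqr ?nnegrE ?cabs_ge0 ?normC2_ge0 // normC2_sqr lerDr sqr_ge0. Qed.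

Lemma nrm_normC2 p : nrm p <= normC2 p.
Proof. by apply/nrm_le; split; [exact: normC2_fst|exact: normC2_snd]. Qed.

Lemma normC2_leD p : normC2 p <= cabs p.1 + cabs p.2.
Proof.
rewrite -ler_sqr ?nnegrE ?addr_ge0 ?cabs_ge0 ?normC2_ge0 // normC2_sqr.
have := cabs_ge0 p.1; have := cabs_ge0 p.2; nra.
Qed.

Lemma normC2_nrm p : normC2 p <= 2 * nrm p.
Proof.
apply: le_trans (normC2_leD p) _.
by rewrite mulr_natl mulr2n lerD ?nrm_fst ?nrm_snd.
Qed.

(* the Euclidean norm of C^2 is the modulus of |p.1| + i |p.2| *)
Lemma normC2_leD2 (p q : C2 R) : normC2 (addC2 p q) <= normC2 p + normC2 q.
Proof.
have cE (u : C2 R) : normC2 u = cabs (cabs u.1 +i* cabs u.2)%C by [].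
rewrite (cE p) (cE q); apply: le_trans (cabsD _ _); rewrite /normC2 /cabs /=.
rewrite ler_sqrt; last by rewrite addr_ge0 ?sqr_ge0.
by rewrite lerD // ler_sqr ?nnegrE ?addr_ge0 ?cabs_ge0 ?sqrtr_ge0 //; exact: cabsD.
Qed.

Lemma addC2_sub p q : addC2 p (subC2 q p) = q.
Proof. by case: p q => a b [c d]; congr pair; rewrite /= addrC subrK. Qed.

Lemma normC2_0 : normC2 (zeroC2 R) = 0.
Proof. by rewrite /normC2 /= cabs0 expr0n /= addr0 sqrtr0. Qed.

End Norms.

(** * Holomorphic maps and automorphisms *)

Section Holomorphy.
Variable R : realType.
Local Notation C := (R[i]).
Implicit Types (p h : C2 R) (f g : C2 R -> C).

(* All maps involved are polynomial, so the differentiability remainder can be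
   taken quadratic; this makes the predicate stable under products at once. *)
Definition hol f := forall p, exists c1 c2 : C, exists2 K : R, 0 <= K &
  forall h, nrm h <= 1 ->
    cabs (f (addC2 p h) - f p - (h.1 * c1 + h.2 * c2)) <= K * nrm h ^+ 2.

Lemma hol_cst (c : C) : hol (fun=> c).
Proof.
move=> p; exists 0, 0, 0 => // h _.
by rewrite !mulr0 addr0 subrr subr0 cabs0 mul0r.
Qed.

Lemma hol_fst : hol fst.
Proof.
move=> p; exists 1, 0, 0 => // h _.
by rewrite /= mulr1 mulr0 addr0 [p.1 + _]addrC addrK subrr cabs0 mul0r.
Qed.

Lemma hol_snd : hol snd.
Proof.
move=> p; exists 0, 1, 0 => // h _.
by rewrite /= mulr1 mulr0 add0r [p.2 + _]addrC addrK subrr cabs0 mul0r.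
Qed.

Lemma hol_add f g : hol f -> hol g -> hol (fun p => f p + g p).
Proof.
move=> hf hg p; have [c1 [c2 [K K0 hK]]] := hf p; have [d1 [d2 [L L0 hL]]] := hg p.
exists (c1 + d1), (c2 + d2), (K + L); first by rewrite addr_ge0.
move=> h h1; rewrite mulrDl; apply: le_trans (lerD (hK h h1) (hL h h1)).
apply: le_trans (cabsD _ _); rewrite le_eqVlt; apply/orP; left; apply/eqP.
by congr cabs; ring.
Qed.

Lemma cabs_lin_le (c1 c2 : C) h :
  cabs (h.1 * c1 + h.2 * c2) <= (cabs c1 + cabs c2) * nrm h.
Proof.
apply: le_trans (cabsD _ _) _; rewrite !cabsM mulrDl.
by rewrite lerD // mulrC ler_wpM2l ?cabs_ge0 ?nrm_fst ?nrm_snd.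
Qed.

Lemma hol_mul f g : hol f -> hol g -> hol (fun p => f p * g p).
Proof.
move=> hf hg p; have [c1 [c2 [K K0 hK]]] := hf p; have [d1 [d2 [L L0 hL]]] := hg p.
set A := cabs c1 + cabs c2; set B := cabs d1 + cabs d2.
have A0 : 0 <= A by rewrite addr_ge0 ?cabs_ge0.
have B0 : 0 <= B by rewrite addr_ge0 ?cabs_ge0.
exists (f p * d1 + g p * c1), (f p * d2 + g p * c2),
  (cabs (f p) * L + cabs (g p) * K + (A * B + A * L + K * B + K * L)).
  by rewrite !addr_ge0 ?mulr_ge0 ?cabs_ge0.
move=> h h1; have n0 := nrm_ge0 h.
have := hK h h1; have := hL h h1.
have := cabs_lin_le c1 c2 h; have := cabs_lin_le d1 d2 h.
rewrite -/A -/B.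
set a := h.1 * c1 + h.2 * c2; set b := h.1 * d1 + h.2 * d2.
set r := f _ - f p - a; set s := g _ - g p - b; set n := nrm h in h1 n0 *.
(* Leibniz rule: the increments of f and g are a + r and b + s, so beyond the linear part there
   remain the weighted remainders and the product (a + r)(b + s). Each term is O(n^2) because n <=
   1. *)
have -> : f (addC2 p h) * g (addC2 p h) - f p * g p -
    (h.1 * (f p * d1 + g p * c1) + h.2 * (f p * d2 + g p * c2)) =
    (f p * s + g p * r) + ((a * b + a * s) + (r * b + r * s)).
  by rewrite /r /s /a /b; ring.
move=> hb ha hs hr.
have n1 : n ^+ 2 <= n by rewrite expr2 ler_piMr.
have b1 u v (x y : R) : cabs u <= x -> cabs v <= y -> cabs (u * v) <= x * y.
  by move=> *; rewrite cabsM ler_pM ?cabs_ge0.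
have n2 : 0 <= n ^+ 2 by rewrite exprn_ge0.
apply: le_trans (cabsD _ _) _; rewrite [leRHS]mulrDl; apply: lerD.
  apply: le_trans (cabsD _ _) _; rewrite [leRHS]mulrDl -!mulrA.
  by rewrite lerD // cabsM ler_wpM2l ?cabs_ge0.
apply: le_trans (cabsD _ _) _.
apply: le_trans (lerD (cabsD _ _) (cabsD _ _)) _.
have := b1 _ _ _ _ ha hb; have := b1 _ _ _ _ ha hs.
have := b1 _ _ _ _ hr hb; have := b1 _ _ _ _ hr hs.
have : A * n * (L * n ^+ 2) <= A * L * n ^+ 2.
  rewrite mulrACA ler_wpM2l ?mulr_ge0 // ler_piMl //.
have : K * n ^+ 2 * (B * n) <= K * B * n ^+ 2.
  rewrite mulrACA ler_wpM2l ?mulr_ge0 // ler_piMr //.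
have : K * n ^+ 2 * (L * n ^+ 2) <= K * L * n ^+ 2.
  rewrite mulrACA ler_wpM2l ?mulr_ge0 // ler_piMr // (le_trans n1) //.
have : A * n * (B * n) = A * B * n ^+ 2 by ring.
nra.
Qed.

Lemma hol_exp f n : hol f -> hol (fun p => f p ^+ n).
Proof.
move=> hf; elim: n => [|n IH]; first exact: hol_cst.
have -> : (fun p => f p ^+ n.+1) = (fun p => f p * f p ^+ n).
  by apply/funext => p; rewrite exprS.
exact: hol_mul.
Qed.

Lemma hol_horner f (P : {poly C}) : hol f -> hol (fun p => P.[f p]).
Proof.
move=> hf; elim/poly_ind: P => [|P c IH].
  have -> : (fun p => (0 : {poly C}).[f p]) = (fun=> 0).
    by apply/funext => p; rewrite horner0.
  exact: hol_cst.
have -> : (fun p => (P * 'X + c%:P).[f p]) = (fun p => P.[f p] * f p + c).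
  by apply/funext => p; rewrite hornerMXaddC.
by apply: hol_add; [exact: hol_mul|exact: hol_cst].
Qed.

Definition holmap (F : C2 R -> C2 R) := hol (fun p => (F p).1) /\ hol (fun p => (F p).2).

Lemma holmap_holomorphic (U : set (C2 R)) F : holmap F -> holomorphicC2 U F.
Proof.
move=> [h1 h2] p _.
have [c1 [c2 [K K0 hK]]] := h1 p; have [d1 [d2 [L L0 hL]]] := h2 p.
exists (c1, d1), (c2, d2) => e e0.
have KL : 0 < K + L + 1 by lra.
(* On this radius (K + L) |h|^2 <= e |h|; the added 1 keeps the denominator positive when K = L =
   0. *)
exists (Num.min 1 (e / (K + L + 1))); first by rewrite lt_min ltr01 divr_gt0.
move=> h; rewrite lt_min => /andP[n1 n2].
have hn := nrm_normC2 h; have n0 := nrm_ge0 h.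
have nh1 : nrm h <= 1 by lra.
apply: le_trans (normC2_leD _) _.
apply: le_trans (lerD (hK h nh1) (hL h nh1)) _.
rewrite -mulrDl; apply: (@le_trans _ _ (e * nrm h)); last by rewrite ler_wpM2l // ltW.
rewrite expr2 mulrA ler_wpM2r //.
have : nrm h * (K + L + 1) <= e.
  by rewrite -ler_pdivlMr //; apply: le_trans hn _; exact: ltW.
nra.
Qed.

Definition contC2 (F : C2 R -> C2 R) := forall U, openC2 U -> openC2 (F @^-1` U).

Lemma holmap_cont F : holmap F -> contC2 F.
Proof.
move=> [h1 h2] U oU p /oU[e e0 he].
have [c1 [c2 [K K0 hK]]] := h1 p; have [d1 [d2 [L L0 hL]]] := h2 p.
set A := K + L + (cabs c1 + cabs c2) + (cabs d1 + cabs d2) + 1.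
have A0 : 0 < A.
  by have := (cabs_ge0 c1, cabs_ge0 c2, cabs_ge0 d1, cabs_ge0 d2); rewrite /A; case=> [[[]]]; lra.
exists (Num.min 1 (e / A)); first by rewrite lt_min ltr01 divr_gt0.
move=> q; rewrite lt_min; set h := subC2 q p => /andP[n1 n2].
have -> : q = addC2 p h by rewrite addC2_sub.
apply: he => /=; apply: le_lt_trans (normC2_leD _) _.
have hn := nrm_normC2 h; have n0 := nrm_ge0 h.
have nh1 : nrm h <= 1 by lra.
have := hK h nh1; have := hL h nh1.
have := cabs_lin_le c1 c2 h; have := cabs_lin_le d1 d2 h.
have tri (x y : C) : cabs x <= cabs (x - y) + cabs y.
  by apply: le_trans (cabsD _ _); rewrite subrK.
move=> l2 l1 k2 k1.
have := le_trans (tri _ _) (lerD k1 l1); have := le_trans (tri _ _) (lerD k2 l2).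
have nn : nrm h ^+ 2 <= nrm h by rewrite expr2 ler_piMr.
have : nrm h * A < e by rewrite -ltr_pdivlMr //; apply: le_lt_trans hn _.
rewrite /A => {}he k2' k1'; apply: le_lt_trans (lerD k1' k2') _.
have := ler_wpM2l K0 nn; have := ler_wpM2l L0 nn; nra.
Qed.

Lemma open_ball (p : C2 R) (r : R) : openC2 [set q | normC2 (subC2 q p) < r].
Proof.
move=> q /= hq; exists (r - normC2 (subC2 q p)); first by rewrite subr_gt0.
move=> s hs /=.
have -> : subC2 s p = addC2 (subC2 s q) (subC2 q p).
  by congr pair; rewrite /= addrA subrK.
by apply: le_lt_trans (normC2_leD2 _ _) _; rewrite -ltrBrDr.
Qed.

Lemma normC2_subxx (p : C2 R) : normC2 (subC2 p p) = 0.
Proof. by rewrite -(normC2_0 R); congr normC2; congr pair; rewrite /= subrr. Qed.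

(** A description of the closure by open sets alone is transported by homeomorphisms, whereas one by
    balls is not; [aut_closure] relies on this. *)
Lemma closureC2P (A : set (C2 R)) p : closureC2 A p <->
  (forall U, openC2 U -> U p -> exists2 q, A q & U q).
Proof.
split=> [cA U oU /oU[r r0 hr]|h e e0].
  by have [q Aq qp] := cA r r0; exists q => //; exact: hr.
have [//|q Aq qp] := h _ (@open_ball p e); last by exists q.
by rewrite /= normC2_subxx.
Qed.

Lemma connectedC2_image (U : set (C2 R)) F : contC2 F -> connectedC2 U ->
  connectedC2 (F @` U).
Proof.
move=> cF cU A B oA oB sub dis.
have [||h|h] := cU (F @^-1` A) (F @^-1` B) (cF _ oA) (cF _ oB).
- by move=> p Up; apply: sub; exists p.
- apply/seteqP; split => // p [[Up Ap] Bp].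
  suff : (F @` U `&` A `&` B) (F p) by rewrite dis.
  by split => //; split => //; exists p.
- left; apply/seteqP; split => // _ [[p Up <-] Ap].
  by suff : (U `&` F @^-1` A) p by rewrite h.
- right; apply/seteqP; split => // _ [[p Up <-] Ap].
  by suff : (U `&` F @^-1` B) p by rewrite h.
Qed.

Lemma compactC2_image (U : set (C2 R)) F : contC2 F -> compactC2 U ->
  compactC2 (F @` U).
Proof.
move=> cF cU I G oG sub.
have [|p Up|D fD hD] := cU I (fun i => F @^-1` G i).
- by move=> i; apply: cF; exact: oG.
- by have [i _ Gi] := sub (F p) (imageP _ Up); exists i.
- by exists D => // _ [p Up <-]; have [i Di Gi] := hD p Up; exists i.
Qed.

Definition autC2 (F G : C2 R -> C2 R) :=
  [/\ holmap F, holmap G, cancel F G & cancel G F].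

Section Aut.
Variables (F G : C2 R -> C2 R).
Hypothesis FG : autC2 F G.

(** The domains of the proof are preimages, while connectedness and compactness pass to continuous
    images; the inverse map converts one into the other. *)
Lemma aut_preimage U : F @^-1` U = G @` U.
Proof.
case: FG => _ _ FK GK; apply/seteqP; split => [p /= Up|_ [p Up <-] /=].
  by exists (F p).
by rewrite GK.
Qed.

Lemma aut_domain U : domainC2 U -> domainC2 (F @^-1` U).
Proof.
have [hF hG FK GK] := FG => -[[p Up] [oU cU]]; split.
  by exists (G p); rewrite /= GK.
split; first exact: holmap_cont.
by rewrite aut_preimage; apply: connectedC2_image => //; exact: holmap_cont.
Qed.

Lemma aut_biholomorphic U : biholomorphicC2 (F @^-1` U) U.
Proof.
have [hF hG FK GK] := FG; exists F, G; split => [||p Up|q Uq].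
- exact: holmap_holomorphic.
- exact: holmap_holomorphic.
- by split => //; exact: FK.
- by rewrite /= GK.
Qed.

Lemma aut_closure U : closureC2 (F @^-1` U) = F @^-1` (closureC2 U).
Proof.
have [hF hG FK GK] := FG; apply/seteqP; split => p /closureC2P cl; apply/closureC2P.
  move=> V oV Vp; have [|q Uq Vq] := cl (F @^-1` V) _ Vp; first exact: holmap_cont.
  by exists (F q).
move=> V oV Vp; have [|| q Uq Vq] := cl (G @^-1` V); first exact: holmap_cont.
  by rewrite /= FK.
by exists (G q) => //=; rewrite GK.
Qed.

Lemma aut_compact U : compactC2 U -> compactC2 (F @^-1` U).
Proof.
have [hF hG FK GK] := FG; rewrite aut_preimage.
by apply: compactC2_image; exact: holmap_cont.
Qed.

End Aut.
End Holomorphy.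

(** * The polydisc and the ball *)

Section ModelDomains.
Variable R : realType.
Local Notation C := (R[i]).
Implicit Types (p q : C2 R).

Lemma compactC2_closed_subset (A K : set (C2 R)) :
  compactC2 K -> openC2 (~` A) -> A `<=` K -> compactC2 A.
Proof.
move=> cK oA AK I G oG sub.
(* The index [None] stands for the complement of A, added to the cover of A to obtain one of K. *)
have [||D fD hD] := cK (option I) (fun i => if i is Some j then G j else ~` A).
- by case.
- move=> p Kp; have [Ap|nAp] := pselect (A p); last by exists None.
  by have [i _ Gi] := sub p Ap; exists (Some i).
exists (Some @^-1` D).
  by apply: finite_preimage => // i j _ _ [].
move=> p Ap; have [[i|] Di Gi] := hD p (AK p Ap); first by exists i.
by case: (Gi Ap).
Qed.

(** Real coordinates on C^2, through which compactness of boxes in R^4 is imported. *)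
Definition of_R4 (x : 'rV[R]_4) : C2 R :=
  ((x ord0 (@Ordinal 4 0 isT) +i* x ord0 (@Ordinal 4 1 isT))%C,
   (x ord0 (@Ordinal 4 2 isT) +i* x ord0 (@Ordinal 4 3 isT))%C).

Lemma open_of_R4 (U : set (C2 R)) : openC2 U -> open (of_R4 @^-1` U).
Proof.
move=> oU; rewrite openE => x /oU[e e0 he].
apply/nbhs_ballP; exists (e / 4); first by rewrite /= divr_gt0.
move=> y xy; apply: he; apply: le_lt_trans (normC2_leD _) _.
apply: le_lt_trans (lerD (cabs_le_ReIm _) (cabs_le_ReIm _)) _.
have h j : `|y ord0 j - x ord0 j| < e / 4.
  by rewrite distrC; case: xy => _ /(_ ord0 j); rewrite -ball_normE.
have := h (@Ordinal 4 0 isT); have := h (@Ordinal 4 1 isT).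
have := h (@Ordinal 4 2 isT); have := h (@Ordinal 4 3 isT).
rewrite /=; lra.
Qed.

Definition closed_polydisc : set (C2 R) := [set p | cabs p.1 <= 1 /\ cabs p.2 <= 1].

Lemma open_polydisc_compl : openC2 (~` closed_polydisc).
Proof.
move=> p /= /not_andP h.
have [e e0 he] : exists2 e, 0 < e & 1 + e <= cabs p.1 \/ 1 + e <= cabs p.2.
  case: h => /negP; rewrite -ltNge => h.
    by exists (cabs p.1 - 1); [lra|left; lra].
  by exists (cabs p.2 - 1); [lra|right; lra].
exists e => // q hq [q1 q2].
have := normC2_fst (subC2 q p); have := normC2_snd (subC2 q p).
have := cabsB q.1 (subC2 q p).1; have := cabsB q.2 (subC2 q p).2.
have eq (x y : C) : x - (x - y) = y by ring.
rewrite !eq; case: he; lra.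
Qed.

Lemma compact_closed_polydisc : compactC2 closed_polydisc.
Proof.
pose I01 : set R := `[(-1 : R), 1].
pose K := [set v : 'rV[R]_4 | forall i, I01 (v ord0 i)].
have cK : compact K by apply: (@rV_compact R 4 (fun=> I01)) => i; exact: segment_compact.
apply: (@compactC2_closed_subset _ (of_R4 @` K)); last 2 first.
- exact: open_polydisc_compl.
- move=> [[a b] [c d]] [/= h1 h2].
  exists (\row_j nth 0 [:: a; b; c; d] j); last by rewrite /of_R4 !mxE.
  have hRe (z : C) : cabs z <= 1 -> I01 (complex.Re z) /\ I01 (complex.Im z).
    move=> hz; have := le_trans (cabs_Re z) hz; have := le_trans (cabs_Im z) hz.
    by rewrite !ler_norml /I01 /= !in_itv /= => -> ->.
  have [? ?] := hRe _ h1; have [? ?] := hRe _ h2.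
  by move=> [[|[|[|[|//]]]] ?]; rewrite mxE.
move=> I G oG sub; move: cK; rewrite compact_cover => cK.
(* [{classic I}] equips the arbitrary index type with the choice structure that the cover form of
   compactness asks for. *)
have [|x Kx|D _ hD] := cK {classic I} setT (fun i => of_R4 @^-1` (G i)).
- by move=> i _; exact: open_of_R4.
- by have [i _ Gi] := sub _ (imageP of_R4 Kx); exists i.
exists [set` D]; first exact: (@finite_fset {classic I}).
by move=> _ [x Kx <-]; have [i Di Gi] := hD x Kx; exists i.
Qed.

Lemma closure_polydisc : closureC2 (@unit_polydisc R) = closed_polydisc.
Proof.
apply/seteqP; split => p.
  move=> cl; apply: contrapT => np.
  have [e e0 he] := open_polydisc_compl np.
  have [q [q1 q2] qp] := cl e e0.
  by apply: (he q qp); split; exact: ltW.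
(* The point p is approximated by (1 - th) p: th <= 1/2 puts it in the open polydisc, and th <= e /
   3 keeps the distance, at most th (|p.1| + |p.2|) <= 2 e / 3, below e. *)
move=> [p1 p2] e e0; set th := Num.min (2^-1) (e / 3).
have th0 : 0 < th by rewrite lt_min invr_gt0 ltr0n /= divr_gt0.
have th1 : th <= 2^-1 by rewrite ge_min lexx.
have th2 : th <= e / 3 by rewrite ge_min lexx orbT.
exists (sclC2 ((1 - th)%:C)%C p).
  have h : `|1 - th| < 1 by rewrite ger0_norm; lra.
  have := cabs_ge0 p.1; have := cabs_ge0 p.2; have := normr_ge0 (1 - th).
  by split; rewrite /= cabsM cabs_real; nra.
have -> : subC2 (sclC2 ((1 - th)%:C)%C p) p = sclC2 ((- th)%:C)%C p.
  by rewrite !rmorphB !rmorphN rmorph1; congr pair => /=; ring.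
apply: le_lt_trans (normC2_leD _) _; rewrite /= !cabsM cabs_real normrN gtr0_norm //.
nra.
Qed.

Definition convexC2 (U : set (C2 R)) := forall p q (t : R), U p -> U q ->
  0 <= t <= 1 -> U (addC2 p (sclC2 (t%:C)%C (subC2 q p))).

(** A separation of U would separate the segment from a point of A to a point of B, against
    connectedness of [0, 1]. *)
Lemma convex_connected U : convexC2 U -> connectedC2 U.
Proof.
move=> cvx A B oA oB sub dis; apply: contrapT => /not_orP[].
move=> /eqP/set0P[p [Up Ap]] /eqP/set0P[q [Uq Bq]].
pose g (t : R) := addC2 p (sclC2 (t%:C)%C (subC2 q p)).
have og V : openC2 V -> open (g @^-1` V).
  move=> oV; rewrite openE => t /oV[e e0 he].
  have n0 : 0 < normC2 (subC2 q p) + 1 by rewrite ltr_wpDl ?normC2_ge0.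
  apply/nbhs_ballP; exists (e / (normC2 (subC2 q p) + 1)); first by rewrite /= divr_gt0.
  move=> s; rewrite -ball_normE /= ltr_pdivlMr // => ts; apply: he.
  have -> : subC2 (g s) (g t) = sclC2 ((s - t)%:C)%C (subC2 q p).
    by rewrite rmorphB /g; congr pair => /=; ring.
  have -> : normC2 (sclC2 ((s - t)%:C)%C (subC2 q p)) = `|s - t| * normC2 (subC2 q p).
    rewrite /normC2 /= !cabsM !exprMn -mulrDr sqrtrM ?sqr_ge0 //.
    by rewrite sqrtr_sqr cabs_real normr_id.
  apply: le_lt_trans ts; rewrite distrC ler_wpM2l //; lra.
pose I01 : set R := `[(0 : R), 1].
have cI : connected I01 by apply/connected_intervalP; exact: interval_is_interval.
have gU t : I01 t -> U (g t) by rewrite /I01 /= in_itv => ht; exact: cvx.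
have g0 : g 0 = p by rewrite [RHS]surjective_pairing; congr pair; rewrite /= mul0r addr0.
have g1 : g 1 = q by rewrite [RHS]surjective_pairing; congr pair; rewrite /= mul1r addrC subrK.
have I0 : I01 0 by rewrite /I01 /= in_itv /= lexx ler01.
have I1 : I01 1 by rewrite /I01 /= in_itv /= lexx ler01.
have AB t : I01 t -> A (g t) -> ~ B (g t).
  move=> It At Bt; suff : (U `&` A `&` B) (g t) by rewrite dis.
  by split => //; split => //; exact: gU.
(* The parameters sent into A form a non-empty subset of [0, 1], open by continuity and closed
   because its complement is the preimage of B. *)
have : I01 `&` g @^-1` A = I01.
  apply: cI.
  - by exists 0; split => //; rewrite /= g0.
  - by exists (g @^-1` A) => //; exact: og.
  - exists (~` (g @^-1` B)); first by apply: open_closedC; exact: og.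
    apply/seteqP; split => t [It ht]; split => //; first exact: AB.
    by have [//|] := sub (g t) (gU t It).
move=> /seteqP[_ /(_ 1 I1)[_ /=]]; rewrite g1 => Aq.
by apply: (AB 1) => //; rewrite g1.
Qed.

Lemma cabs_convex (z w : C) (t : R) : 0 <= t <= 1 ->
  cabs (z + t%:C%C * (w - z)) <= (1 - t) * cabs z + t * cabs w.
Proof.
move=> /andP[t0 t1].
have -> : z + t%:C%C * (w - z) = (1 - t)%:C%C * z + t%:C%C * w.
  by rewrite rmorphB rmorph1; ring.
apply: le_trans (cabsD _ _) _; rewrite !cabsM !cabs_real !ger0_norm //; lra.
Qed.

Lemma convex_lt1 (t x y : R) : 0 <= t <= 1 -> x < 1 -> y < 1 ->
  (1 - t) * x + t * y < 1.
Proof.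
move=> /andP[]; rewrite le_eqVlt => /orP[/eqP <- _ x1 _|t0 t1 x1 y1].
  by rewrite subr0 mul1r mul0r addr0.
have : (1 - t) * x <= (1 - t) * 1 by rewrite ler_wpM2l ?subr_ge0 // ltW.
have : t * y < t * 1 by rewrite ltr_pM2l.
lra.
Qed.

Lemma domain_polydisc : domainC2 (@unit_polydisc R).
Proof.
split; first by exists (zeroC2 R); split; rewrite /= cabs0.
split.
  move=> p [p1 p2]; exists (Num.min (1 - cabs p.1) (1 - cabs p.2)).
    by rewrite lt_min !subr_gt0 p1 p2.
  move=> q; rewrite lt_min => /andP[h1 h2]; rewrite -(addC2_sub p q).
  by split; apply: le_lt_trans (cabsD _ _) _;
    rewrite -ltrBrDl; [apply: le_lt_trans h1|apply: le_lt_trans h2];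
    [exact: normC2_fst|exact: normC2_snd].
apply: convex_connected => p q t [p1 p2] [q1 q2] ht.
by split; apply: le_lt_trans (cabs_convex _ _ ht) _; exact: convex_lt1.
Qed.

Lemma domain_ball : domainC2 (@unit_ball R).
Proof.
split; first by exists (zeroC2 R); rewrite /unit_ball /= normC2_0.
split.
  move=> p p1; exists (1 - normC2 p); first by rewrite subr_gt0.
  move=> q hq; rewrite /unit_ball /= -(addC2_sub p q).
  by apply: le_lt_trans (normC2_leD2 _ _) _; rewrite -ltrBrDl.
apply: convex_connected => p q t p1 q1 ht; have /andP[t0 t1] := ht.
rewrite /unit_ball /=.
have -> : addC2 p (sclC2 t%:C%C (subC2 q p)) =
    addC2 (sclC2 (1 - t)%:C%C p) (sclC2 t%:C%C q).
  by rewrite rmorphB rmorph1; congr pair => /=; ring.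
have nZ s u : 0 <= s -> normC2 (sclC2 s%:C%C u) = s * normC2 u.
  move=> s0; rewrite /normC2 /= !cabsM !exprMn -mulrDr sqrtrM ?sqr_ge0 //.
  by rewrite sqrtr_sqr cabs_real !ger0_norm.
apply: le_lt_trans (normC2_leD2 _ _) _; rewrite !nZ ?subr_ge0 //.
exact: convex_lt1.
Qed.

End ModelDomains.

(** * Dynamics near the origin *)

Section Dynamics.
Variables (R : realType) (d : nat) (a : R).
Variables (q : nat -> {poly R[i]}) (delta : nat -> R[i]).
Local Notation C := (R[i]).
Hypothesis d2 : (2 <= d)%N.
Hypothesis a01 : 0 < a < 1.
Hypothesis hF : forall n, (1 <= n)%N ->
  [/\ delta n != 0, (size (q n) <= d)%N,
      (forall i, cabs (q n)`_i <= a ^+ (d ^ n)) & cabs (delta n) <= a ^+ (d ^ n)].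

Local Notation F := (fun n => Fmap d (q n) (delta n)).
Local Notation G := (compF F).
Local Notation e n := (a ^+ (d ^ n)).
Local Notation Fn n := (Fmap d (q n) (delta n)).
Implicit Types (p v : C2 R) (n : nat).

Lemma e_gt0 n : 0 < e n.
Proof. by case/andP: a01 => a0 _; rewrite exprn_gt0. Qed.

Lemma e_S n : e n.+1 = e n ^+ d.
Proof. by rewrite -exprM expnSr. Qed.

Lemma e_small (c : R) : 0 < c -> exists n0, forall n, (n0 <= n)%N -> e n < c.
Proof.
move=> c0; case/andP: a01 => a0 a1.
have /cvg_expr/cvgrPdist_lt cvg0 : `|a| < 1 by rewrite gtr0_norm.
have [n0 _ h] := cvg0 c c0.
exists n0 => n n0n; have := h (d ^ n)%N.
rewrite /= sub0r normrN ger0_norm ?exprn_ge0 ?ltW //; apply.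
by apply: leq_trans n0n _; rewrite ltnW // ltn_expl.
Qed.

Lemma horner_bound (P : {poly C}) (m : nat) (c : R) (z : C) : (size P <= m)%N ->
  (forall i, cabs P`_i <= c) -> cabs z <= 1 -> cabs P.[z] <= m%:R * c.
Proof.
move=> sP hP z1; rewrite (horner_coef_wide z sP).
apply: le_trans (cabs_sum _ _) _.
apply: (@le_trans _ _ (\sum_(i < m) c)).
  apply: ler_sum => i _; rewrite cabsM cabsX.
  apply: le_trans (hP i); rewrite ler_piMr ?cabs_ge0 //.
  by rewrite exprn_ile1 ?cabs_ge0.
by rewrite sumr_const card_ord mulr_natl.
Qed.

Lemma q_bound n z : (1 <= n)%N -> cabs z <= 1 -> cabs (q n).[z] <= d%:R * e n.
Proof. by move=> /hF[_ s c _]; exact: horner_bound. Qed.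

Lemma dq_bound n z : (1 <= n)%N -> cabs z <= 1 ->
  cabs (q n)^`().[z] <= d%:R * (d%:R * e n).
Proof.
move=> /hF[_ s c _]; apply: horner_bound => [|i].
  have [->|/lt_size_deriv/ltnW sq] := eqVneq (q n) 0; first by rewrite derivC size_poly0.
  exact: leq_trans sq s.
rewrite coef_deriv.
have [di|di] := leqP d i.
  rewrite nth_default ?mul0rn ?cabs0 ?mulr_ge0 ?ler0n ?(ltW (e_gt0 _)) //.
  by rewrite (leq_trans s) // ltnW.
by rewrite -[X in cabs X]mulr_natl cabsM ler_pM ?cabs_ge0 // -(rmorph_nat (real_complex R))
  cabs_real normr_nat ler_nat.
Qed.

Lemma zdq_bound n z (r : R) : (1 <= n)%N -> cabs z <= r -> r <= 1 ->
  cabs (z ^+ d + (q n).[z]) <= r ^+ d + d%:R * e n.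
Proof.
move=> n1 zr r1; apply: le_trans (cabsD _ _) _; rewrite cabsX.
apply: lerD; last by apply: q_bound => //; exact: le_trans zr r1.
by rewrite lerXn2r ?nnegrE ?cabs_ge0 // (le_trans (cabs_ge0 z)).
Qed.

Lemma F_fst_le n p (r : R) : (1 <= n)%N -> nrm p <= r -> r <= 1 ->
  cabs (Fn n p).1 <= r ^+ d + (d.+1)%:R * e n.
Proof.
move=> n1 /nrm_le[z1 w1] r1; apply: le_trans (cabsD _ _) _.
have := zdq_bound n1 z1 r1; have [_ _ _ hd] := hF n1.
rewrite cabsM -natr1 mulrDl mul1r.
have : cabs (delta n) * cabs p.2 <= e n * 1.
  by rewrite ler_pM ?cabs_ge0 // (le_trans w1).
rewrite /=; lra.
Qed.

Lemma F_snd_le n p (r : R) : (1 <= n)%N -> nrm p <= r ->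
  cabs (Fn n p).2 <= e n * r.
Proof.
move=> n1 /nrm_le[z1 w1]; have [_ _ _ hd] := hF n1.
by rewrite cabsM ler_pM ?cabs_ge0.
Qed.

Lemma F_nrm_le n p (r : R) : (1 <= n)%N -> nrm p <= r -> r <= 1 ->
  nrm (Fn n p) <= r ^+ d + (d.+1)%:R * e n.
Proof.
move=> n1 pr r1; apply/nrm_le; split; first exact: F_fst_le.
apply: le_trans (F_snd_le n1 pr) _; have r0 := le_trans (nrm_ge0 p) pr.
have e0 := e_gt0 n; have : 0 <= r ^+ d by rewrite exprn_ge0.
have : e n * r <= e n * 1 by rewrite ler_wpM2l // ltW.
have : 1 * e n <= d.+1%:R * e n by rewrite ler_wpM2r ?ler1n // ltW.
lra.
Qed.

Lemma exp_d_le (x : R) : 0 <= x <= 1 -> x ^+ d <= x ^+ 2.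
Proof. by move=> /andP[x0 x1]; apply: ler_wiXn2l. Qed.

(** * Trapping in the polydisc of radius 1/8 *)

Section Threshold.
Variable n0 : nat.
(** In d + 2, d counts the coefficients of q_n, one unit is for the delta_n term and one is spare.
    The bound 1/64 makes the polydisc of radius 1/8 invariant, and 1/64 < 1/32 later separates two
    values of [green]. *)
Hypothesis hn0 : forall n, (n0 <= n)%N -> (d.+2)%:R * e n <= 64^-1.

Lemma e_le n : (n0 <= n)%N -> e n <= 64^-1 / 4.
Proof.
move=> /hn0; have := e_gt0 n.
have : 4 * e n <= (d.+2)%:R * e n by rewrite ler_wpM2r ?(ltW (e_gt0 _)) // ler_nat.
lra.
Qed.

Lemma dSe_le n : (n0 <= n)%N -> (d.+1)%:R * e n <= 64^-1 - e n.
Proof. by move=> /hn0; rewrite -[d.+2%:R]natr1 mulrDl; lra. Qed.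

Lemma e_S_le n : (n0 <= n)%N -> e n.+1 <= e n / 64.
Proof.
move=> n0n; rewrite e_S; have e1 := e_le n0n; have e0 := e_gt0 n.
apply: le_trans (exp_d_le _) _; first by apply/andP; split; lra.
by rewrite expr2 ler_wpM2l ?(ltW e0) //; lra.
Qed.

Lemma G_step n p : (n0 <= n)%N -> nrm (G n p) <= 8^-1 ->
  nrm (G n.+1 p) <= nrm (G n p) / 8 + (d.+1)%:R * e n.+1.
Proof.
move=> n0n h; apply: le_trans (F_nrm_le _ (lexx _) _) _ => //; first lra.
rewrite lerD2r; have := nrm_ge0 (G n p) => h0.
apply: le_trans (exp_d_le _) _; first by apply/andP; split; lra.
by rewrite expr2 ler_wpM2l.
Qed.

Lemma G_step_lt n p : (n0 <= n)%N -> nrm (G n p) < 8^-1 -> nrm (G n.+1 p) < 8^-1.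
Proof.
move=> n0n h; have := G_step n0n (ltW h).
have := dSe_le (leqW n0n); have := e_gt0 n.+1; lra.
Qed.

Lemma G_lt_mono m n p : (n0 <= m <= n)%N -> nrm (G m p) < 8^-1 -> nrm (G n p) < 8^-1.
Proof.
move=> /andP[n0m /subnK <-] h; elim: (n - m)%N => // k IH.
by rewrite addSn; apply: G_step_lt => //; exact: leq_trans n0m (leq_addl _ _).
Qed.

(** Adding the error term makes the recursion homogeneous: one step yields at most |G_n p| / 8 + 2
    (d+1) e_(n+1), and e_(n+1) <= e_n / 64. *)
Lemma G_decay n k p : (n0 <= n)%N -> nrm (G n p) < 8^-1 ->
  nrm (G (n + k) p) + (d.+1)%:R * e (n + k) <= 8^-1 ^+ k * (nrm (G n p) + (d.+1)%:R * e n).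
Proof.
move=> n0n h; elim: k => [|k IH]; first by rewrite addn0 expr0 mul1r.
have n0k : (n0 <= n + k)%N by exact: leq_trans n0n (leq_addr _ _).
have hk : nrm (G (n + k) p) < 8^-1 by apply: G_lt_mono h; rewrite n0n leq_addr.
have := G_step n0k (ltW hk).
have : (d.+1)%:R * e (n + k).+1 <= (d.+1)%:R * (e (n + k) / 64).
  by rewrite ler_wpM2l // e_S_le.
have := e_gt0 (n + k); have := nrm_ge0 (G (n + k) p).
have : 0 <= d.+1%:R * e (n + k) by rewrite mulr_ge0 ?(ltW (e_gt0 _)).
rewrite addnS exprS; move: IH; set X := _ * (_ + _ : R); rewrite -mulrA -/X.
lra.
Qed.

(** An orbit that enters the polydisc of radius 1/8 after time n0 stays there and decays
    geometrically. Membership in the basin thus becomes an open condition on a single iterate. *)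
Lemma basinP p : basin F p <-> exists2 n, (n0 <= n)%N & nrm (G n p) < 8^-1.
Proof.
split=> [/cvgrPdist_lt cvg0|[n n0n h]].
  have [|N _ hN] := cvg0 8^-1; first by rewrite invr_gt0.
  exists (maxn n0 N); first exact: leq_maxl.
  apply: le_lt_trans (nrm_normC2 _) _.
  have := hN (maxn n0 N) (leq_maxr _ _).
  by rewrite /= sub0r normrN ger0_norm ?normC2_ge0.
apply/cvgrPdist_lt => c c0.
set A := nrm (G n p) + (d.+1)%:R * e n.
have A0 : 0 < A by rewrite ltr_wpDl ?nrm_ge0 // mulr_gt0 ?e_gt0.
have /cvg_expr/cvgrPdist_lt cvg0 : `|8^-1 : R| < 1 by rewrite ger0_norm; lra.
have [|N _ hN] := cvg0 (c / 2 / A); first by rewrite !divr_gt0.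
exists (n + N)%N => // m; rewrite /= => nm.
rewrite sub0r normrN ger0_norm ?normC2_ge0 //.
have -> : m = (n + (m - n))%N by lia.
have Nm : (N <= m - n)%N by lia.
have := hN _ Nm; rewrite /= sub0r normrN ger0_norm ?exprn_ge0 ?invr_ge0 //.
rewrite ltr_pdivlMr // => h1.
have := G_decay (m - n) n0n h; rewrite -/A.
have := normC2_nrm (G (n + (m - n)) p).
have : 0 < d.+1%:R * e (n + (m - n)) by rewrite mulr_gt0 ?e_gt0.
lra.
Qed.

Lemma basin_small p (c : R) : basin F p -> 0 < c ->
  exists2 N, (n0 <= N)%N & forall n, (N <= n)%N -> nrm (G n p) < c.
Proof.
move=> /cvgrPdist_lt cvg0 /cvg0[N _ hN]; exists (maxn n0 N); first exact: leq_maxl.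
move=> n; rewrite geq_max => /andP[_ Nn]; apply: le_lt_trans (nrm_normC2 _) _.
by have := hN n Nn; rewrite /= sub0r normrN ger0_norm ?normC2_ge0.
Qed.

End Threshold.
End Dynamics.

(** * Polynomial automorphisms *)

Section PolynomialAutomorphisms.
Variable R : realType.
Local Notation C := (R[i]).
Implicit Types (F G : C2 R -> C2 R).

(** Phrased as stability of [holmap] under composition on the left, which holds for polynomial
    expressions by the closure rules of [hol] and composes at once. *)
Definition polymap F := forall f, holmap f -> holmap (F \o f).

Definition polyaut F G := [/\ polymap F, polymap G, cancel F G & cancel G F].

Lemma polyaut_comp F1 G1 F2 G2 : polyaut F1 G1 -> polyaut F2 G2 ->
  polyaut (F2 \o F1) (G1 \o G2).
Proof.
move=> [f1 g1 k1 l1] [f2 g2 k2 l2]; split.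
- by move=> f hf; exact/f2/f1.
- by move=> f hf; exact/g1/g2.
- exact: can_comp.
- exact: can_comp.
Qed.

Lemma polyaut_autC2 F G : polyaut F G -> autC2 F G.
Proof.
have hid : holmap (@id (C2 R)) by split; [exact: hol_fst|exact: hol_snd].
by move=> [f g k l]; split => //; [exact: (f id)|exact: (g id)].
Qed.

Lemma holZ (c : C) (f : C2 R -> C) : hol f -> hol (fun p => c * f p).
Proof. by apply: hol_mul; exact: hol_cst. Qed.

Lemma holB (f g : C2 R -> C) : hol f -> hol g -> hol (fun p => f p - g p).
Proof.
move=> hf hg; have -> : (fun p => f p - g p) = (fun p => f p + -1 * g p).
  by apply/funext => p; rewrite mulN1r.
exact/hol_add/holZ.
Qed.

Definition scale (c : C) (p : C2 R) : C2 R := (c * p.1, c * p.2).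

Lemma polyaut_scale (c : C) : c != 0 -> polyaut (scale c) (scale c^-1).
Proof.
move=> c0; have pm (b : C) : polymap (scale b).
  by move=> f [h1 h2]; split; exact: holZ.
by split => // p; rewrite [RHS]surjective_pairing /scale /= ?mulVKf ?mulKf.
Qed.

Section Shear.
Variables (d : nat) (q : {poly C}) (dl s c sg : C).
Hypotheses (dl0 : dl != 0) (s0 : s != 0) (sg0 : sg != 0).

(** For positive reals s and sg, the preimage of the unit polydisc is the domain |z| < s, |dl w + c
    (z^d + q(z))| < sg of the Loewner chain. *)
Definition shear (p : C2 R) : C2 R :=
  (s^-1 * p.1, sg^-1 * (dl * p.2 + c * (p.1 ^+ d + q.[p.1]))).

Definition shear_inv (p : C2 R) : C2 R :=
  (s * p.1, dl^-1 * (sg * p.2 - c * ((s * p.1) ^+ d + q.[s * p.1]))).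

Lemma polyaut_shear : polyaut shear shear_inv.
Proof.
split.
- move=> f [h1 h2]; split; apply: holZ => //; apply: hol_add; apply: holZ => //.
  by apply: hol_add; [exact: hol_exp|exact: hol_horner].
- move=> f [h1 h2]; split; apply: holZ => //; apply: holB; apply: holZ => //.
  have h : hol (fun p => s * (f p).1) by exact: holZ.
  by apply: hol_add; [exact: hol_exp|exact: hol_horner].
- by move=> p; rewrite [RHS]surjective_pairing /shear_inv /= !mulVKf // addrK mulKf.
- by move=> p; rewrite [RHS]surjective_pairing /shear /= !mulVKf // subrK !mulKf.
Qed.
End Shear.

Section Iterates.
Variables (d : nat) (q : nat -> {poly C}) (delta : nat -> C).
Hypothesis delta_neq0 : forall n, (1 <= n)%N -> delta n != 0.
Local Notation G := (compF (fun n => Fmap d (q n) (delta n))).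

Definition Finv n (p : C2 R) : C2 R :=
  ((delta n)^-1 * p.2, (delta n)^-1 *
    (p.1 - (((delta n)^-1 * p.2) ^+ d + (q n).[(delta n)^-1 * p.2]))).

Fixpoint Ginv n (p : C2 R) : C2 R :=
  if n is m.+1 then Ginv m (Finv m.+1 p) else p.

Lemma polyaut_F n : (1 <= n)%N -> polyaut (Fmap d (q n) (delta n)) (Finv n).
Proof.
move=> /delta_neq0 d0; split.
- move=> f [h1 h2]; split; last exact: holZ.
  by apply: hol_add; [apply: hol_add; [exact: hol_exp|exact: hol_horner]|exact: holZ].
- move=> f [h1 h2]; split; first exact: holZ.
  apply: holZ; apply: holB => //; have h := holZ (delta n)^-1 h2.
  by apply: hol_add; [exact: hol_exp|exact: hol_horner].
- by move=> p; rewrite [RHS]surjective_pairing /Finv /= !mulKf // [X in X - _]addrC addrK mulKf.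
- by move=> p; rewrite [RHS]surjective_pairing /Fmap /= !mulVKf // addrC subrK.
Qed.

Lemma polyaut_G n : polyaut (G n) (Ginv n).
Proof.
elim: n => [|n IH]; first by split => // f hf.
exact: polyaut_comp IH (polyaut_F _).
Qed.

End Iterates.
End PolynomialAutomorphisms.

(** * Polynomial discs *)

Section PolynomialDiscs.
Variable R : realType.
Local Notation C := (R[i]).

Lemma poly_taylor_bound (P : {poly C}) (z : C) : exists2 K : R, 0 <= K &
  forall h, cabs h <= 1 -> cabs (P.[z + h] - P.[z] - h * P^`().[z]) <= K * cabs h ^+ 2.
Proof.
elim/poly_ind: P => [|P c [K K0 IH]].
  by exists 0 => // h _; rewrite derivC !horner0 mulr0 !subr0 cabs0 mul0r.
exists (K * (cabs z + 1) + cabs P^`().[z]).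
  by rewrite addr_ge0 ?mulr_ge0 ?cabs_ge0 // addr_ge0 ?cabs_ge0.
move=> h h1; rewrite derivD derivM derivX derivC mulr1 addr0 !hornerMXaddC hornerD hornerMX.
have -> : P.[z + h] * (z + h) + c - (P.[z] * z + c) - h * (P^`().[z] * z + P.[z]) =
  (P.[z + h] - P.[z] - h * P^`().[z]) * (z + h) + h * h * P^`().[z] by ring.
have -> : (K * (cabs z + 1) + cabs P^`().[z]) * cabs h ^+ 2 =
  K * cabs h ^+ 2 * (cabs z + 1) + cabs h * cabs h * cabs P^`().[z] by ring.
apply: le_trans (cabsD _ _) _; rewrite !cabsM.
apply: lerD => //.
  apply: ler_pM; rewrite ?cabs_ge0 ?IH //.
  by apply: le_trans (cabsD _ _) _; rewrite lerD2l.
Qed.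

Definition evalP (P : {poly C} * {poly C}) (z : C) : C2 R := (P.1.[z], P.2.[z]).

Definition derP (P : {poly C} * {poly C}) := (deriv P.1, deriv P.2).

Lemma cderiv_evalP P z : cderiv (evalP P) z (evalP (derP P) z).
Proof.
have [K K0 hK] := poly_taylor_bound P.1 z; have [L L0 hL] := poly_taylor_bound P.2 z.
move=> e e0; have KL : 0 < K + L + 1 by lra.
exists (Num.min 1 (e / (K + L + 1))); first by rewrite lt_min ltr01 divr_gt0.
move=> h; rewrite lt_min ltr_pdivlMr // => /andP[/ltW h1 h2].
apply: le_trans (normC2_leD _) _; apply: le_trans (lerD (hK h h1) (hL h h1)) _.
rewrite -mulrDl expr2 mulrA ler_wpM2r ?cabs_ge0 //.
by have := cabs_ge0 h; nra.
Qed.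

Variables (d : nat) (q : nat -> {poly C}) (delta : nat -> C).
Hypothesis delta_neq0 : forall n, (1 <= n)%N -> delta n != 0.
Local Notation G := (compF (fun n => Fmap d (q n) (delta n))).

(** The complex differential of F_n at p applied to v; [DG] is that of G_n, built by the chain rule
    along the orbit. *)
Definition DF n (p v : C2 R) : C2 R :=
  ((d%:R * p.1 ^+ d.-1 + (q n)^`().[p.1]) * v.1 + delta n * v.2, delta n * v.1).

Fixpoint DG n (p v : C2 R) : C2 R :=
  if n is m.+1 then DF m.+1 (G m p) (DG m p v) else v.

(** The inverse of F_n acting on discs parametrized by polynomials: pulled-back discs stay
    polynomial, and formal derivatives give their tangent vectors. *)
Definition FinvP n (P : {poly C} * {poly C}) :=
  ((delta n)^-1 *: P.2, (delta n)^-1 *: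
    (P.1 - (((delta n)^-1 *: P.2) ^+ d + (q n \Po ((delta n)^-1 *: P.2))))).

Fixpoint GinvP n (P : {poly C} * {poly C}) :=
  if n is m.+1 then GinvP m (FinvP m.+1 P) else P.

Lemma evalP_GinvP n P z : evalP (GinvP n P) z = Ginv d q delta n (evalP P z).
Proof.
elim: n P => //= n IH P; rewrite IH; congr Ginv.
by rewrite /evalP /Finv /= !(hornerZ, hornerD, hornerN) horner_exp horner_comp !hornerZ.
Qed.

(** With Q = [FinvP n P], the polynomial identity P = F_n(Q) is differentiated formally; this is the
    chain rule. *)
Lemma derP_FinvP n P z : (1 <= n)%N ->
  evalP (derP P) z = DF n (evalP (FinvP n P) z) (evalP (derP (FinvP n P)) z).
Proof.
move=> /delta_neq0 d0; set Q := FinvP n P.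
have P1 : P.1 = Q.1 ^+ d + (q n \Po Q.1) + delta n *: Q.2.
  by rewrite /Q /FinvP /= scalerA divff // scale1r addrC subrK.
have P2 : P.2 = delta n *: Q.1 by rewrite /Q /= scalerA divff // scale1r.
clearbody Q; rewrite /evalP /derP /DF /= P1 P2; congr pair; last by rewrite derivZ hornerZ.
rewrite !derivD derivZ deriv_comp deriv_exp !(hornerD, hornerZ, hornerMn, hornerM) horner_exp horner_comp.
by rewrite -mulr_natl; ring.
Qed.

Lemma DF_inj n p : (1 <= n)%N -> injective (DF n p).
Proof.
move=> /delta_neq0 d0 [v1 v2] [w1 w2] [/= h /(mulfI d0) e1].
by move: h; rewrite -e1 => /(addrI _)/(mulfI d0) ->.
Qed.

Lemma DG_inj n p : injective (DG n p).
Proof.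
elim: n => //= n IH v w h; apply: IH; exact: (@DF_inj n.+1 (G n p)) h.
Qed.

Lemma DGZ n p c v : DG n p (sclC2 c v) = sclC2 c (DG n p v).
Proof.
elim: n => //= n ->; rewrite /DF /sclC2 /=; congr pair; ring.
Qed.

Lemma derP_GinvP n P z :
  evalP (derP P) z = DG n (evalP (GinvP n P) z) (evalP (derP (GinvP n P)) z).
Proof.
elim: n P => //= n IH P; rewrite -IH (@derP_FinvP n.+1) //; congr DF.
rewrite evalP_GinvP.
by have [_ _ _ ->] := polyaut_G d q delta_neq0 n.
Qed.

End PolynomialDiscs.

(** * The Kobayashi metric *)

Section Kobayashi.
Variables (R : realType) (d : nat) (a : R).
Variables (q : nat -> {poly R[i]}) (delta : nat -> R[i]).
Local Notation C := (R[i]).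
Hypothesis d2 : (2 <= d)%N.
Hypothesis a01 : 0 < a < 1.
Hypothesis hF : forall n, (1 <= n)%N ->
  [/\ delta n != 0, (size (q n) <= d)%N,
      (forall i, cabs (q n)`_i <= a ^+ (d ^ n)) & cabs (delta n) <= a ^+ (d ^ n)].
Variable n0 : nat.
Hypothesis hn0 : forall n, (n0 <= n)%N -> (d.+2)%:R * a ^+ (d ^ n) <= 64^-1.

Local Notation F := (fun n => Fmap d (q n) (delta n)).
Local Notation G := (compF F).
Local Notation e n := (a ^+ (d ^ n)).
Local Notation Fn n := (Fmap d (q n) (delta n)).
Implicit Types (p v : C2 R) (n : nat).

Let delta_neq0 n : (1 <= n)%N -> delta n != 0.
Proof. by move=> /hF[]. Qed.

Lemma DF_bound n p v (r : R) : (1 <= n)%N -> nrm p <= r -> r <= 1 ->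
  nrm (DF d q delta n p v) <= (d%:R * r + (d%:R * (d%:R * e n) + e n)) * nrm v.
Proof.
move=> n1 pr r1; have [z1 _] := (nrm_le p r).1 pr.
have r0 := le_trans (nrm_ge0 p) pr.
have [_ _ _ hd] := hF n1; have n0' := nrm_ge0 v; have e0 := e_gt0 d a01 n.
have b1 : cabs (d%:R * p.1 ^+ d.-1 + (q n)^`().[p.1]) <= d%:R * r + d%:R * (d%:R * e n).
  apply: le_trans (cabsD _ _) _; apply: lerD; last first.
    by apply: (dq_bound a01 hF n1); exact: le_trans r1.
  rewrite cabsM -(rmorph_nat (real_complex R)) cabs_real normr_nat ler_wpM2l //.
  rewrite cabsX; apply: (le_trans _ z1).
  (* As d >= 2, the exponent d - 1 is positive, so |z|^(d-1) <= |z|. *)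
  case: (d) d2 => [|[|m]] //= _; rewrite exprS ler_piMr ?cabs_ge0 //.
  by rewrite exprn_ile1 ?cabs_ge0 // (le_trans z1).
apply/nrm_le; rewrite /DF /=; split.
  apply: le_trans (cabsD _ _) _; rewrite addrA [leRHS]mulrDl !cabsM.
  by apply: lerD; apply: ler_pM; rewrite ?cabs_ge0 ?nrm_fst ?nrm_snd.
rewrite cabsM mulrDl mulrDl addrA; apply: ler_wpDl.
  by rewrite addr_ge0 ?mulr_ge0 ?(ltW e0).
by apply: ler_pM; rewrite ?cabs_ge0 ?nrm_fst.
Qed.

(* the differential of F_n at a point near 0 contracts, so it kills every
   tangent vector along an orbit tending to 0 *)
Lemma DG_small p v (c : R) : basin F p -> 0 < c ->
  exists2 n, (n0 <= n)%N & nrm (G n p) < c /\ nrm (DG d q delta n p v) < c.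
Proof.
move=> bp c0.
have D0 : 0 < d%:R :> R by rewrite ltr0n; case: (d) d2.
(* Past both thresholds the factor in [DF_bound] is at most 1/4 + 1/4: d / (4 d) from the orbit and
   (d^2 + 1) e_n <= 1/4 from the coefficients. Each further step then halves tangent vectors. *)
have [|N1 N1n hN1] := basin_small n0 bp (_ : 0 < Num.min c (4 * d%:R)^-1).
  by rewrite lt_min c0 invr_gt0 mulr_gt0.
have DD : 0 < 4 * (d%:R * d%:R + 1) :> R by rewrite mulr_gt0 // addr_gt0 ?mulr_gt0.
have [|N2 hN2] := e_small d2 a01 (_ : 0 < (4 * (d%:R * d%:R + 1))^-1); first by rewrite invr_gt0.
set N := maxn N1 N2.
have half k : nrm (DG d q delta (N + k) p v) <= 2^-1 ^+ k * nrm (DG d q delta N p v).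
  elim: k => [|k IH]; first by rewrite addn0 expr0 mul1r.
  rewrite addnS /=; have := hN1 (N + k)%N; rewrite lt_min => h1.
  have /andP[_ g1] := h1 (leq_trans (leq_maxl _ _) (leq_addr _ _)).
  have e2 := hN2 (N + k).+1 (leqW (leq_trans (leq_maxr _ _) (leq_addr _ _))).
  have D1 : 1 <= d%:R :> R by rewrite ler1n; case: (d) d2.
  apply: le_trans (DF_bound _ _ (ltW g1) _) _ => //.
    by rewrite invf_le1 ?mulr_gt0 //; lra.
  have -> : d%:R * (4 * d%:R)^-1 = 4^-1 :> R by field; rewrite lt0r_neq0.
  have -> : d%:R * (d%:R * e (N + k).+1) + e (N + k).+1 = (d%:R * d%:R + 1) * e (N + k).+1.
    by ring.
  have h2 : (d%:R * d%:R + 1) * e (N + k).+1 <= 4^-1.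
    rewrite mulrC -ler_pdivlMr ?addr_gt0 ?mulr_gt0 //; apply: le_trans (ltW e2) _.
    by rewrite invfM.
  rewrite exprS -mulrA; apply: ler_pM => //; rewrite ?nrm_ge0 //; last lra.
  by rewrite addr_ge0 ?mulr_ge0 ?addr_ge0 ?mulr_ge0 ?(ltW (e_gt0 _ a01 _)) ?(ltW D0).
have /cvg_expr/cvgrPdist_lt cvg0 : `|2^-1 : R| < 1 by rewrite ger0_norm; lra.
set A := nrm (DG d q delta N p v) in half.
have A0 : 0 <= A by exact: nrm_ge0.
have [|K _ hK] := cvg0 (c / (A + 1)); first by rewrite divr_gt0 // ltr_wpDl.
exists (N + K)%N; first by rewrite (leq_trans N1n) // (leq_trans (leq_maxl _ _) (leq_addr _ _)).
split.
  have := hN1 (N + K)%N (leq_trans (leq_maxl _ _) (leq_addr _ _)).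
  by rewrite lt_min => /andP[].
have := hK K (leqnn K); rewrite /= sub0r normrN ger0_norm ?exprn_ge0 //.
rewrite ltr_pdivlMr ?ltr_wpDl // => h.
apply: le_lt_trans (half K) _; apply: le_lt_trans h.
by rewrite ler_wpM2l ?exprn_ge0 //; lra.
Qed.

Lemma large_disc p v (r : R) : basin F p -> 0 < r ->
  exists phi, [/\ holo_disc (basin F) phi, phi 0 = p & cderiv phi 0 (sclC2 (r +i* 0)%C v)].
Proof.
move=> bp r0.
have [|n n0n [gp gv]] := DG_small v bp (_ : 0 < Num.min 16^-1 (16 * r)^-1).
  by rewrite lt_min !invr_gt0 mulr_gt0 // andbT; lra.
move: gp gv; rewrite !lt_min => /andP[gp _] /andP[_ gv].
set xi := DG d q delta n p v in gv.
(* The affine disc through G_n(p) with velocity r DG_n(p) v. Its centre has norm below 1/16 and so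
   has its velocity, so it lies in the polydisc of radius 1/8 and its pull-back lies in the
   basin. *)
pose A := ((G n p).1%:P + (r%:C%C * xi.1) *: 'X, (G n p).2%:P + (r%:C%C * xi.2) *: 'X).
have [_ _ GK GK'] := polyaut_G d q delta_neq0 n.
have A0 : evalP A 0 = G n p.
  by rewrite [RHS]surjective_pairing /evalP /A /= !hornerE ?mulr0 ?addr0.
have dA0 : evalP (derP A) 0 = sclC2 r%:C%C xi.
  by rewrite /evalP /derP /A /sclC2 /= !derivD !derivC !derivZ !derivX !add0r !hornerE.
exists (evalP (GinvP d q delta n A)); split.
- split=> z z1; first by exists (evalP (derP (GinvP d q delta n A)) z); exact: cderiv_evalP.
  apply/(basinP d2 a01 hF hn0); exists n => //; rewrite evalP_GinvP GK'.
  have b (x y : C) : cabs x < 16^-1 -> cabs y < (16 * r)^-1 ->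
      cabs (x + r%:C%C * y * z) < 8^-1.
    move=> x1 y1; apply: le_lt_trans (cabsD _ _) _; rewrite !cabsM cabs_real gtr0_norm //.
    have y2 : r * cabs y < 16^-1.
      by rewrite mulrC -ltr_pdivlMr // -invfM.
    have : r * cabs y * cabs z <= r * cabs y.
      by rewrite ler_piMr ?mulr_ge0 ?cabs_ge0 // ltW.
    lra.
  by apply/nrm_lt; rewrite /evalP /A /= !hornerE; split; apply: b;
    rewrite ?(le_lt_trans (nrm_fst _) gp) ?(le_lt_trans (nrm_snd _) gp)
            ?(le_lt_trans (nrm_fst _) gv) ?(le_lt_trans (nrm_snd _) gv).
- by rewrite evalP_GinvP A0 GK.
- have -> : sclC2 (r +i* 0)%C v = evalP (derP (GinvP d q delta n A)) 0.
    (* Both tangent vectors have image r DG_n(p) v under the injective differential DG_n(p). *)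
    apply: (@DG_inj _ d q delta delta_neq0 n p); rewrite DGZ.
    have := derP_GinvP d q delta_neq0 n A 0.
    by rewrite evalP_GinvP A0 GK dA0.
  exact: cderiv_evalP.
Qed.

Lemma kobayashi_basin p v : basin F p -> kobayashi_royden (basin F) p v = 0%E.
Proof.
move=> bp; apply/eqP; rewrite eq_le; apply/andP; split.
  apply/lee_addgt0Pr => c c0; rewrite add0e.
  have ci : 0 < c^-1 by rewrite invr_gt0.
  apply: ereal_inf_lbound; exists c^-1; last by rewrite invrK.
  by have [phi [h1 h2 h3]] := large_disc v bp ci; split => //; exists phi.
apply: le_ereal_inf_tmp => _ [r [r0 _] <-].
by rewrite lee_fin invr_ge0 ltW.
Qed.

End Kobayashi.

(** * Sub-mean value inequality *)

Section MeanValue.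
Variable R : realType.
Local Notation C := (R[i]).
Implicit Types (t s : R) (z : C) (g P : {poly C}).

Lemma expiD s t : expi (s + t) = expi s * expi t :> C.
Proof.
apply/eqP; rewrite eq_complex /= cosD sinD.
by apply/andP; split; apply/eqP; ring.
Qed.

Lemma expi0 : expi 0 = 1 :> C.
Proof. by rewrite /expi cos0 sin0. Qed.

Lemma expiMn t n : expi (t *+ n) = expi t ^+ n :> C.
Proof. by elim: n => [|n IH]; rewrite ?mulr0n ?expi0 // mulrS expiD IH exprS. Qed.

Lemma expi_2pi : expi (2 * pi) = 1 :> C.
Proof. by rewrite mulr_natl /expi cos2pi sin2pi. Qed.

Definition uroot (N : nat) : C := expi (2 * pi / N%:R).

Lemma uroot_exp N : (0 < N)%N -> uroot N ^+ N = 1.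
Proof.
move=> N0; rewrite /uroot -expiMn -[X in expi X]mulr_natr divfK ?expi_2pi //.
by rewrite pnatr_eq0 -lt0n.
Qed.

Lemma expi_neq1 t : 0 < t < 2 * pi -> expi t != 1 :> C.
Proof.
move=> /andP[t0 t1]; apply/negP => /eqP[ct _].
(* Half-angle formula: cos t = 1 - 2 sin(t/2)^2, which is less than 1 when sin(t/2) > 0. *)
have : 0 < sin (t / 2) by apply: sin_gt0_pi; apply/andP; split; lra.
have : cos (t / 2 + t / 2) = 1 by have -> : t / 2 + t / 2 = t by field.
rewrite cosD -!expr2; have := cos2Dsin2 (t / 2); nra.
Qed.

(** Discrete mean value property: over the N-th roots of unity, the powers z^i with 0 < i < N sum to
    zero as geometric series. *)
Lemma sum_roots N P : (0 < N)%N -> (size P <= N)%N ->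
  \sum_(j < N) P.[uroot N ^+ j] = N%:R * P.[0].
Proof.
case: N => // N _ sP.
under eq_bigr => j _ do rewrite (horner_coef_wide _ sP).
rewrite exchange_big big_ord_recl /= [X in _ + X]big1 => [|i _].
  rewrite addr0; under eq_bigr do rewrite expr0 mulr1.
  by rewrite sumr_const card_ord horner_coef0 mulr_natl.
rewrite -mulr_sumr; set w := uroot N.+1 ^+ lift ord0 i.
under eq_bigr => j _ do rewrite exprAC -/w.
have w1 : w - 1 != 0.
  rewrite subr_eq0 /w /uroot -expiMn; apply: expi_neq1; rewrite -[_ *+ lift _ _]mulr_natr.
  have N0 : 0 < N.+1%:R :> R by [].
  apply/andP; split; first by rewrite !mulr_gt0 ?pi_gt0 ?invr_gt0 //= ltr0n.
  rewrite -mulrA gtr_pMr ?mulr_gt0 ?pi_gt0 // mulrC ltr_pdivrMr // mul1r ltr_nat.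
  exact: ltn_ord.
suff -> : \sum_(j < N.+1) w ^+ j = 0 by rewrite mulr0.
apply: (mulfI w1); rewrite mulr0 -subrX1 /w exprAC uroot_exp //.
by rewrite expr1n subrr.
Qed.

Lemma max_roots N P : (0 < N)%N -> (size P <= N)%N ->
  exists j, cabs P.[0] <= cabs P.[uroot N ^+ j].
Proof.
move=> N0 sP; apply: contrapT => /forallNP h.
have : cabs (\sum_(j < N) P.[uroot N ^+ j]) < N%:R * cabs P.[0].
  apply: le_lt_trans (cabs_sum _ _) _.
  apply: (@lt_le_trans _ _ (\sum_(j < N) cabs P.[0])).
    apply: ltr_sum => [|j _]; last by have /negP := h j; rewrite -ltNge.
    by apply/hasP; exists (Ordinal N0); rewrite ?mem_index_enum.
  by rewrite sumr_const card_ord mulr_natl.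
by rewrite sum_roots // cabsM -(rmorph_nat (real_complex R)) cabs_real normr_nat ltxx.
Qed.

(* The product of the rotates of g by the N-th roots of unity is invariant
   under these rotations, so the point produced by the maximum principle may
   be rotated into the arc [0, 2 pi / N). *)
Lemma max_rotated_product N g : (0 < N)%N ->
  exists t, 0 <= t <= 2 * pi / N%:R /\
    cabs g.[0] ^+ N <= \prod_(k < N) cabs g.[expi (t + 2 * pi / N%:R *+ k)].
Proof.
move=> N0; set w := uroot N.
pose P := \prod_(k < N) (g \Po (w ^+ k *: 'X)).
have PE z : P.[z] = \prod_(k < N) g.[w ^+ k * z].
  by rewrite horner_prod; apply: eq_bigr => k _; rewrite horner_comp hornerZ hornerX.
have Pw z : P.[w * z] = P.[z].
  rewrite !PE; case: (N) N0 (uroot_exp N0) @w {P PE} => // m _ wm w.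
  rewrite big_ord_recr big_ord_recl /= mulrC; congr (_ * _).
    by rewrite mulrA -exprSr wm expr0.
  by apply: eq_bigr => i _; rewrite mulrA -exprSr.
have Pwn z n : P.[w ^+ n * z] = P.[z].
  by elim: n => [|n IH]; rewrite ?mul1r // exprS -mulrA Pw.
(* The (N L)-th roots of unity are fine enough for the degree of P, and the L-th power of the
   primitive one is w. *)
pose L := (size P).+1.
have NL : (0 < N * L)%N by rewrite muln_gt0 N0.
have [|j hj] := @max_roots (N * L) P NL.
  by rewrite (leq_trans (leqnSn _)) // leq_pmull.
have wL : uroot (N * L) ^+ L = w.
  rewrite /uroot -expiMn -[_ *+ L]mulr_natr natrM; congr expi; field.
  by rewrite !pnatr_eq0 -!lt0n N0.
(* The quotient of j by L contributes a power of w, under which P is invariant; the remainder leaves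
   an angle in [0, 2 pi / N]. *)
rewrite (divn_eq j L) exprD [(_ %/ _ * _)%N]mulnC exprM wL Pwn in hj.
exists (2 * pi / (N * L)%:R *+ (j %% L)); split.
  rewrite mulrn_wge0 ?divr_ge0 ?mulr_ge0 ?pi_ge0 //= -[_ *+ (j %% L)]mulr_natr.
  have -> : 2 * pi / N%:R = 2 * pi / (N * L)%:R * L%:R :> R.
    by rewrite natrM; field; rewrite !pnatr_eq0 -!lt0n N0.
  rewrite ler_wpM2l ?divr_ge0 ?mulr_ge0 ?pi_ge0 // ler_nat ltnW //.
  by rewrite ltn_mod.
have -> : cabs g.[0] ^+ N = cabs P.[0].
  rewrite -cabsX PE; under eq_bigr do rewrite mulr0.
  by rewrite prodr_const card_ord.
apply: (le_trans hj); rewrite PE.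
rewrite le_eqVlt; apply/orP; left; apply/eqP.
elim/big_ind2: _ => [|x1 x2 y1 y2 <- <-|k _]; first exact: cabs1.
  by rewrite cabsM.
by rewrite expiD !expiMn mulrC.
Qed.

(** Heine's theorem: around each point a half-radius works locally for all small dl, and the
    near-covering form of compactness makes dl uniform. *)
Lemma segment_unif_continuous (f : R -> R) (A : set R) : compact A -> continuous f ->
  forall c : R, 0 < c -> exists2 dl : R, 0 < dl &
    forall x, A x -> forall y, `|x - y| < dl -> `|f x - f y| < c.
Proof.
move=> cA cf c c0.
have /compact_near_coveringP ncA := cA.
have := ncA R (0^'+) (fun dl x => forall y, `|x - y| < dl -> `|f x - f y| < c) _ _.
case.
  move=> x Ax; have c2 : 0 < c / 2 by rewrite divr_gt0.
  have /cvgrPdist_lt /(_ _ c2) := cf x.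
  move=> /nbhs_ballP[r r0 hr].
  have r2 : 0 < r / 2 by rewrite divr_gt0.
  exists (ball x (r / 2), [set dl | dl < r / 2]); first split => /=.
  - exact: nbhsx_ballx.
  - exact: nbhs_right_lt.
  - move=> [x' dl] [/= xx' dlr] y xy.
    rewrite -ball_normE /= in xx'.
    have h1 := hr x'; have h2 := hr y; rewrite -ball_normE /= in h1 h2.
    have x'r : `|x - x'| < r by apply: lt_trans xx' _; rewrite gtr_pMr // invf_lt1 // ltr1n.
    have yr : `|x - y| < r.
      apply: le_lt_trans (ler_distD x' x y) _.
      by rewrite [r]splitr ltrD // (lt_trans xy).
    apply: le_lt_trans (ler_distD (f x) _ _) _.
    by rewrite [c]splitr ltrD // ?h2 // distrC h1.
move=> dl /= dl0 h.
exists (dl / 2); first by rewrite divr_gt0.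
by move=> x Ax y xy; apply: (h (dl / 2)) => //=; rewrite ?divr_gt0 // sub0r normrN gtr0_norm; lra.
Qed.

End MeanValue.

(** * From roots of unity to integrals over the circle *)

Section IntegralMeanValue.
Variable R : realType.
Local Notation C := (R[i]).
Local Notation mu := (@lebesgue_measure R).

Lemma continuous_integrable_segment (f : R -> R) (x y : R) : continuous f ->
  mu.-integrable `[x, y] (EFin \o f).
Proof.
move=> cf; apply: continuous_compact_integrable; first exact: segment_compact.
exact: continuous_subspaceT.
Qed.

(** The c k are arbitrary lower bounds on the cells, because the sample points supplied by the
    rotated product are shifted inside each cell. *)
Lemma riemann_lower (f : R -> R) (h : R) (c : nat -> R) m : continuous f -> 0 < h ->
  (forall k x, (k < m)%N -> h *+ k <= x <= h *+ k + h -> c k <= f x) ->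
  h * \sum_(k < m) c k <= \int[mu]_(x in `[0, h *+ m]) f x.
Proof.
move=> cf h0; elim: m => [|m IH] hc.
  by rewrite big_ord0 mulr0 mulr0n set_itv1 Rintegral_set1.
rewrite big_ord_recr /= mulrDr.
have hm : 0 <= h *+ m by rewrite mulrn_wge0 // ltW.
have hS : h *+ m.+1 = h *+ m + h by rewrite mulrSr.
have := @Rintegral_itvB R f (BLeft 0) (BRight (h *+ m.+1)) (h *+ m)
  (continuous_integrable_segment 0 _ cf).
rewrite !bnd_simp hS lerDl => /(_ hm (ltW h0)) /eqP; rewrite subr_eq => /eqP ->.
rewrite [leRHS]addrC.
apply: lerD; first by apply: IH => k x km; apply: hc; exact: ltnW.
have io : mu.-integrable `]h *+ m, h *+ m + h] (EFin \o f).
  apply: integrableS (continuous_integrable_segment (h *+ m) (h *+ m + h) cf) => //.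
  by apply: subset_itvr; rewrite bnd_simp.
rewrite Rintegral_itv_obnd_cbnd //.
have -> : h * c m = \int[mu]_(x in `[h *+ m, h *+ m + h]) (c m).
  have muE : mu `[h *+ m, h *+ m + h] = h%:E.
    by rewrite lebesgue_measure_itv /= lte_fin ltrDl h0 -EFinD addrAC subrr add0r.
  by rewrite Rintegral_cst // mulrC; congr (_ * _); rewrite -[LHS]/(fine h%:E) -muE.
apply: le_Rintegral => //.
- exact: (continuous_integrable_segment _ _ (fun x => @cst_continuous _ _ (c m) x)).
- exact: continuous_integrable_segment.
- by move=> x; rewrite /= in_itv /=; exact: hc.
Qed.

Lemma ln_prod (m : nat) (x : 'I_m -> R) : (forall k, 0 < x k) ->
  ln (\prod_(k < m) x k) = \sum_(k < m) ln (x k).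
Proof.
move=> x0; suff [] : 0 < \prod_(k < m) x k /\
  ln (\prod_(k < m) x k) = \sum_(k < m) ln (x k) by [].
elim/big_ind2: _ => [|u v y z [u0 <-] [y0 <-]|k _]; first by rewrite ln1.
  by rewrite mulr_gt0 // lnM.
by split.
Qed.

(** The logarithm of [max_rotated_product] bounds N ln |g(0)| by a sum of f over N equally spaced
    points. Zeros of g on the circle are excluded from the hypothesis because [ln] has only a
    default value at 0. *)
Lemma mean_value_ln (f : R -> R) (g : {poly C}) : continuous f -> g.[0] != 0 ->
  (forall t, g.[expi t] != 0 -> ln (cabs g.[expi t]) <= f t) ->
  2 * pi * ln (cabs g.[0]) <= \int[mu]_(t in `[0, 2 * pi]) f t.
Proof.
move=> cf g0 hf; apply/ler_addgt0Pr => c c0.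
have pi2 : 0 < 2 * pi :> R by rewrite mulr_gt0 ?pi_gt0.
have [|dl dl0 hdl] := segment_unif_continuous (@segment_compact R 0 (2 * pi)) cf
  (_ : 0 < c / (2 * pi)); first by rewrite divr_gt0.
(* The mesh 2 pi / N is below the modulus of continuity for c / (2 pi), so replacing each cell by
   its sample value costs at most c in total. *)
set N := Num.bound (2 * pi / dl).
have hN : 2 * pi / dl < N%:R by apply: archi_boundP; rewrite ltW // divr_gt0.
have N0r : 0 < N%:R :> R by apply: lt_trans hN; rewrite divr_gt0.
have N0 : (0 < N)%N by rewrite -(ltr0n R).
pose h : R := 2 * pi / N%:R.
have h0 : 0 < h by rewrite divr_gt0.
have hd : h < dl by rewrite /h ltr_pdivrMr // [dl * _]mulrC -ltr_pdivrMr //.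
have hNE : h *+ N = 2 * pi by rewrite -[LHS]mulr_natr /h divfK // lt0r_neq0.
have [t [/andP[t0 th] hprod]] := max_rotated_product g N0.
rewrite -/h in th hprod.
have := @riemann_lower f h (fun k => f (t + h *+ k) - c / (2 * pi)) N cf h0.
rewrite hNE => riem.
have {}riem := riem _.
have low : h * (\sum_(k < N) (f (t + h *+ k) - c / (2 * pi))) <=
    \int[mu]_(x in `[0, 2 * pi]) f x.
  apply: riem => k x kN /andP[x1 x2].
  have hk : h *+ k + h <= 2 * pi.
    by rewrite -hNE -mulrSr ler_wpMn2l // ltW.
  have hk0 : 0 <= h *+ k by rewrite mulrn_wge0 // ltW.
  have tk : `[0, 2 * pi]%classic (t + h *+ k).
    by rewrite /= in_itv /=; apply/andP; split; lra.
  have d1 : `|t + h *+ k - x| < dl by rewrite ltr_norml; apply/andP; split; lra.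
  have := hdl _ tk x d1; rewrite ltr_norml => /andP[_]; lra.
apply: (@le_trans _ _ (h * \sum_(k < N) f (t + h *+ k))); last first.
  rewrite sumrB sumr_const card_ord mulrBr in low.
  have e : h * (c / (2 * pi) *+ N) = c.
    by rewrite mulrnAr -mulrnAl hNE mulrC divfK // lt0r_neq0.
  by move: low; rewrite e; lra.
(* A zero at a sample point would make the product vanish, although it is at least |g(0)|^N > 0. *)
have pk k : 0 < cabs g.[expi (t + h *+ k)] \/ (k >= N)%N.
  have [kN|] := ltnP k N; last by right.
  left; rewrite cabs_gt0; apply/negP => /eqP z.
  move: hprod; rewrite (bigD1 (Ordinal kN)) //= z cabs0 mul0r leNgt.
  by rewrite exprn_gt0 ?cabs_gt0.
have pk' (k : 'I_N) : 0 < cabs g.[expi (t + h *+ k)].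
  by case: (pk k) => //; rewrite leqNgt ltn_ord.
apply: (@le_trans _ _ (h * ln (cabs g.[0] ^+ N))).
  by rewrite -hNE lnXn ?cabs_gt0 // mulrnAr mulrnAl.
rewrite ler_pM2l //; apply: (@le_trans _ _ (ln (\prod_(k < N) cabs g.[expi (t + h *+ k)]))).
  by rewrite ler_ln // posrE ?exprn_gt0 ?cabs_gt0 // prodr_gt0.
by rewrite ln_prod //; apply: ler_sum => k _; apply: hf; rewrite -cabs_gt0.
Qed.

Lemma continuous_ReIm_horner (g : {poly C}) :
  continuous (fun t : R => complex.Re g.[expi t]) /\
  continuous (fun t : R => complex.Im g.[expi t]).
Proof.
elim/poly_ind: g => [|g c [hr hi]].
  have -> : (fun t : R => complex.Re (0 : {poly C}).[expi t]) = (fun=> 0).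
    by apply/funext => t; rewrite horner0.
  have -> : (fun t : R => complex.Im (0 : {poly C}).[expi t]) = (fun=> 0).
    by apply/funext => t; rewrite horner0.
  by split; exact: cst_continuous.
split.
  have -> : (fun t : R => complex.Re (g * 'X + c%:P).[expi t]) =
      (fun t => complex.Re g.[expi t] * cos t - complex.Im g.[expi t] * sin t + complex.Re c).
    by apply/funext => t; rewrite hornerMXaddC complexReD complexReM.
  move=> t; apply: cvgD; last exact: cvg_cst.
  apply: cvgB; apply: cvgM; [exact: hr|exact: continuous_cos|exact: hi|exact: continuous_sin].
have -> : (fun t : R => complex.Im (g * 'X + c%:P).[expi t]) =
    (fun t => complex.Re g.[expi t] * sin t + complex.Im g.[expi t] * cos t + complex.Im c).
  by apply/funext => t; rewrite hornerMXaddC complexImD complexImM.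
move=> t; apply: cvgD; last exact: cvg_cst.
apply: cvgD; apply: cvgM; [exact: hr|exact: continuous_sin|exact: hi|exact: continuous_cos].
Qed.

Lemma continuous_cabs_horner (g : {poly C}) : continuous (fun t : R => cabs g.[expi t]).
Proof.
have [hr hi] := continuous_ReIm_horner g => t.
apply: continuous_comp; last exact: sqrt_continuous.
by apply: cvgD; apply: cvgM; [exact: hr|exact: hr|exact: hi|exact: hi].
Qed.

End IntegralMeanValue.

(** * The plurisubharmonic function *)

Section Potential.
Variables (R : realType) (d : nat) (a : R).
Variables (q : nat -> {poly R[i]}) (delta : nat -> R[i]).
Local Notation C := (R[i]).
Hypothesis d2 : (2 <= d)%N.
Hypothesis a01 : 0 < a < 1.
Hypothesis hF : forall n, (1 <= n)%N ->
  [/\ delta n != 0, (size (q n) <= d)%N,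
      (forall i, cabs (q n)`_i <= a ^+ (d ^ n)) & cabs (delta n) <= a ^+ (d ^ n)].
Variable n0 : nat.
Hypothesis hn0 : forall n, (n0 <= n)%N -> (d.+2)%:R * a ^+ (d ^ n) <= 64^-1.

Local Notation F := (fun n => Fmap d (q n) (delta n)).
Local Notation G := (compF F).
Local Notation e n := (a ^+ (d ^ n)).
Local Notation Fn n := (Fmap d (q n) (delta n)).
Implicit Types (p v : C2 R) (n : nat).

Let delta_neq0 n : (1 <= n)%N -> delta n != 0.
Proof. by move=> /hF[]. Qed.

Local Notation mu := (@lebesgue_measure R).

Let Bd : R := d.+2%:R.
Let Bd_gt0 : 0 < Bd. Proof. by rewrite ltr0n. Qed.
Let Bd_ge1 : 1 <= Bd. Proof. by rewrite ler1n. Qed.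
Let D_gt0 n : 0 < (d ^ n)%:R :> R.
Proof. by rewrite ltr0n expn_gt0; case: (d) d2. Qed.

(** The truncation at e_n keeps the argument of [ln] positive and provides the lower bound
    [K_ge]. *)
Definition phi n p : R := Num.max (nrm (G n p)) (e n).

Definition K n p : R := ln (Bd * phi n p) / (d ^ n)%:R.

Definition green p : R := limn (K ^~ p).

Lemma e_phi n p : e n <= phi n p.
Proof. by rewrite le_max lexx orbT. Qed.

Lemma phi_gt0 n p : 0 < phi n p.
Proof. by apply: lt_le_trans (e_phi n p); exact: e_gt0. Qed.

Lemma phi_step n p : nrm (G n p) <= 1 -> Bd * phi n.+1 p <= (Bd * phi n p) ^+ d.
Proof.
move=> g1; have ph0 := ltW (phi_gt0 n p).
have e1 : e n.+1 <= phi n p ^+ d.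
  by rewrite e_S lerXn2r ?nnegrE ?(ltW (e_gt0 _ a01 _)) // e_phi.
have pd0 : 0 <= phi n p ^+ d by exact: exprn_ge0.
have h : phi n.+1 p <= Bd * phi n p ^+ d.
  rewrite ge_max; apply/andP; split; last first.
    by apply: (le_trans e1); rewrite ler_peMl.
  apply: le_trans (F_nrm_le a01 hF _ (lexx _) g1) _ => //.
  rewrite /Bd -[d.+2%:R]natr1 mulrDl mul1r addrC.
  apply: lerD; first by rewrite ler_wpM2l.
  by rewrite lerXn2r ?nnegrE ?nrm_ge0 // le_max lexx.
(* The two factors B are absorbed by B^d, since B >= 1 and d >= 2. *)
apply: (@le_trans _ _ (Bd * (Bd * phi n p ^+ d))); first by rewrite ler_pM2l.
rewrite exprMn mulrA ler_wpM2r // -expr2; exact: ler_weXn2l.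
Qed.

Lemma K_step n p : nrm (G n p) <= 1 -> K n.+1 p <= K n p.
Proof.
move=> /phi_step h; have b0 := mulr_gt0 Bd_gt0 (phi_gt0 n p).
have b1 := mulr_gt0 Bd_gt0 (phi_gt0 n.+1 p).
rewrite /K expnS natrM invfM mulrA ler_pM2r ?invr_gt0 //.
rewrite ler_pdivrMr ?ltr0n; last by case: (d) d2.
rewrite mulr_natr -lnXn //.
by rewrite ler_ln // posrE ?exprn_gt0.
Qed.

(** Here B phi_n >= e_n = a^(d^n), and division by d^n turns its logarithm into ln a. *)
Lemma K_ge n p : ln a <= K n p.
Proof.
have /andP[a0 _] := a01.
rewrite /K ler_pdivlMr // mulr_natr -lnXn // ler_ln ?posrE ?exprn_gt0 ?mulr_gt0 ?phi_gt0 //.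
by apply: le_trans (e_phi n p) _; rewrite ler_peMl // ltW // phi_gt0.
Qed.

Lemma K_le n p : nrm (G n p) <= 1 -> K n p <= ln Bd.
Proof.
move=> g1; have /andP[a0 a1] := a01.
rewrite /K ler_pdivrMr //; apply: (@le_trans _ _ (ln Bd)).
  rewrite ler_ln ?posrE ?mulr_gt0 ?phi_gt0 // ler_piMr ?(ltW Bd_gt0) //.
  by rewrite ge_max g1 exprn_ile1 // ltW.
by rewrite ler_peMr ?ln_ge0 // ler1n expn_gt0; case: (d) d2.
Qed.

Lemma green_cvg n p : (n0 <= n)%N -> nrm (G n p) < 8^-1 ->
  K ^~ p @ \oo --> green p /\ green p <= K n p.
Proof.
move=> n0n gn.
have g1 k : nrm (G (n + k) p) <= 1.
  have : nrm (G (n + k) p) < 8^-1.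
    by apply: (G_lt_mono d2 a01 hF hn0) gn; rewrite n0n leq_addr.
  lra.
have ni : nonincreasing_seq (fun k => K (k + n) p).
  by apply/nonincreasing_seqP => k; rewrite addSn; apply: K_step; rewrite addnC.
have cv : cvgn (fun k => K (k + n) p).
  apply: nonincreasing_is_cvgn => //; exists (ln a) => _ [k _ <-]; exact: K_ge.
have cv' : K ^~ p @ \oo --> limn (fun k => K (k + n) p).
  by rewrite -(cvg_shiftn n).
have -> : green p = limn (fun k => K (k + n) p) by apply/cvg_lim.
by split => //; exact: (nonincreasing_cvgn_ge ni cv 0%N).
Qed.

Lemma green_le p : basin F p -> green p <= ln Bd.
Proof.
move=> /(basinP d2 a01 hF hn0)[n n0n gn]; have [_ h] := green_cvg n0n gn.
by apply: (le_trans h); apply: K_le; lra.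
Qed.

Lemma open_nrm_lt (r : R) : openC2 [set p : C2 R | nrm p < r].
Proof.
move=> p /= pr; exists (r - nrm p); first by rewrite subr_gt0.
move=> s; rewrite ltrBrDl => h; rewrite -(addC2_sub p s).
by apply/nrm_lt; split; apply: le_lt_trans (cabsD _ _) _; apply: le_lt_trans h;
  rewrite lerD ?nrm_fst ?nrm_snd ?normC2_fst ?normC2_snd.
Qed.

Lemma holmap_id : holmap (@id (C2 R)).
Proof. by split; [exact: hol_fst|exact: hol_snd]. Qed.

Lemma open_G_lt n (r : R) : openC2 [set p | nrm (G n p) < r].
Proof.
have [/(_ _ holmap_id) h _ _ _] := polyaut_G d q delta_neq0 n.
exact: (holmap_cont h (@open_nrm_lt r)).
Qed.

(** Some K_n is below c at p; this is an open condition, and K_n bounds [green] from above near p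
    because the sequence decreases there. *)
Lemma green_usc p (c : R) : basin F p -> green p < c ->
  exists2 dl : R, 0 < dl & forall s, basin F s -> normC2 (subC2 s p) < dl -> green s < c.
Proof.
move=> bp gc; have /(basinP d2 a01 hF hn0)[n1 n0n1 gn1] := bp.
have [cv _] := green_cvg n0n1 gn1.
have /cvgrPdist_lt /(_ (c - green p)) := cv; rewrite subr_gt0 => /(_ gc)[n2 _ hn2].
pose n := maxn n1 n2.
have n0n : (n0 <= n)%N by rewrite (leq_trans n0n1) // leq_maxl.
have gn : nrm (G n p) < 8^-1.
  by apply: (G_lt_mono d2 a01 hF hn0) gn1; rewrite n0n1 leq_maxl.
have Kc : K n p < c.
  by have := hn2 n (leq_maxr _ _); rewrite /= ltr_norml => /andP[]; lra.
(* Solving K_n(s) < c for phi_n(s) exhibits the condition as an open sublevel set. *)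
pose X := expR (c * (d ^ n)%:R) / Bd.
have KE s : (K n s < c) = (phi n s < X).
  rewrite /K /X ltr_pdivrMr // ltr_pdivlMr // [_ * Bd]mulrC.
  by rewrite -[c * _ in LHS]expRK ltr_ln ?posrE ?expR_gt0 ?mulr_gt0 ?phi_gt0.
move: Kc; rewrite KE gt_max => /andP[gX eX].
have [dl1 d10 h1] := @open_G_lt n 8^-1 p gn; have [dl2 d20 h2] := @open_G_lt n X p gX.
exists (Num.min dl1 dl2); first by rewrite lt_min d10.
move=> s bs; rewrite lt_min => /andP[s1 s2].
have [_ h] := green_cvg n0n (h1 s s1); apply: (le_lt_trans h).
by rewrite KE gt_max eX andbT; exact: h2.
Qed.

(** The open sets |G_n| < 1/8 increase and cover the compact disc, so one index serves the whole
    circle. The disc is handled as the first factor of the closed bidisc. *)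
Lemma circle_bound (b1 b2 : C2 R) :
  (forall z : C, cabs z <= 1 -> basin F (addC2 b1 (sclC2 z b2))) ->
  exists2 n, (n0 <= n)%N & forall t : R, nrm (G n (addC2 b1 (sclC2 (expi t) b2))) < 8^-1.
Proof.
move=> hb; pose L p := addC2 b1 (sclC2 p.1 b2).
have hL : holmap L.
  by split; apply: hol_add; [exact: hol_cst| |exact: hol_cst|];
    apply: hol_mul; [exact: hol_fst|exact: hol_cst|exact: hol_fst|exact: hol_cst].
have [|p [p1 _]|D' fD hD] := @compact_closed_polydisc R nat
    (fun i => [set p | nrm (G (n0 + i) (L p)) < 8^-1]).
- by move=> i; exact: (holmap_cont hL (@open_G_lt (n0 + i) 8^-1)).
- have /(basinP d2 a01 hF hn0)[n n0n gn] := hb p.1 p1.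
  by exists (n - n0)%N => //=; rewrite subnKC.
have /finite_seqP[s sE] := fD.
exists (n0 + \max_(i <- s) i)%N; first exact: leq_addr.
move=> t; have [|i Di] := hD (expi t, 0).
  by split; rewrite /= ?cabs_expi ?cabs0.
move=> /= gi; apply: (G_lt_mono d2 a01 hF hn0) gi.
rewrite leq_addr leq_add2l; apply: (@leq_bigmax_seq _ _ xpredT (fun i => i)) => //.
by move: Di; rewrite sE.
Qed.

Lemma G_poly n (b1 b2 : C2 R) : exists g1 g2 : {poly C}, forall z,
  G n (addC2 b1 (sclC2 z b2)) = (g1.[z], g2.[z]).
Proof.
elim: n => [|n [g1 [g2 IH]]].
  exists (b1.1%:P + b2.1 *: 'X), (b1.2%:P + b2.2 *: 'X) => z.
  by rewrite /= !hornerE /addC2 /sclC2 /= ![z * _]mulrC.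
exists (g1 ^+ d + (q n.+1 \Po g1) + delta n.+1 *: g2), (delta n.+1 *: g1) => z.
by rewrite /= IH /Fmap /= !(hornerD, hornerZ) horner_exp horner_comp.
Qed.

Lemma circle_continuous n (b1 b2 : C2 R) :
  continuous (fun t : R => ln (Bd * phi n (addC2 b1 (sclC2 (expi t) b2)))).
Proof.
have [g1 [g2 gE]] := G_poly n b1 b2.
move=> t; apply: continuous_comp; last first.
  by apply: continuous_ln; rewrite mulr_gt0 ?phi_gt0.
apply: cvgM; first exact: cvg_cst.
rewrite /phi /nrm.
apply: (@continuous_max _ _ (fun t => nrm (G n (addC2 b1 (sclC2 (expi t) b2)))) (fun=> e n)); last exact: cvg_cst.
have -> : (fun t : R => nrm (G n (addC2 b1 (sclC2 (expi t) b2)))) =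
    (fun t => Num.max (cabs g1.[expi t]) (cabs g2.[expi t])).
  by apply/funext => s; rewrite gE.
by apply: continuous_max; exact: continuous_cabs_horner.
Qed.

Lemma K_submean n (b1 b2 : C2 R) :
  2 * pi * K n b1 <= \int[mu]_(t in `[0, 2 * pi]) K n (addC2 b1 (sclC2 (expi t) b2)).
Proof.
have [g1 [g2 gE]] := G_poly n b1 b2.
have cf := @circle_continuous n b1 b2.
rewrite /K mulrA RintegralZr //; last exact: continuous_integrable_segment.
rewrite ler_pM2r ?invr_gt0 //.
have g0 : G n b1 = (g1.[0], g2.[0]).
  rewrite -gE; congr compF.
  by rewrite [LHS]surjective_pairing; congr pair; rewrite /= mul0r addr0.
have cB (z : C) : cabs (Bd%:C%C * z) = Bd * cabs z.
  by rewrite cabsM cabs_real gtr0_norm.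
(* The maximum at the centre is attained by B g1, B g2 or the constant B e_n; that polynomial stays
   below the maximum along the circle. *)
have [g [hg0 hg]] : exists g : {poly C}, cabs g.[0] = Bd * phi n b1 /\
    forall t, cabs g.[expi t] <= Bd * phi n (addC2 b1 (sclC2 (expi t) b2)).
  have [->|[->|->]] : phi n b1 = cabs g1.[0] \/ phi n b1 = cabs g2.[0] \/ phi n b1 = e n.
    rewrite /phi g0 /nrm /=; case: (leP (cabs g1.[0]) (cabs g2.[0])) => _.
      by case: (leP (cabs g2.[0]) (e n)) => _; auto.
    by case: (leP (cabs g1.[0]) (e n)) => _; auto.
  - exists (Bd%:C%C *: g1); split => [|t]; rewrite hornerZ cB //.
    by rewrite ler_pM2l // /phi gE !le_max /= lexx.
  - exists (Bd%:C%C *: g2); split => [|t]; rewrite hornerZ cB //.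
    by rewrite ler_pM2l // /phi gE !le_max /= lexx orbT.
  - exists (Bd%:C * (e n)%:C)%C%:P.
    by split => [|t]; rewrite hornerC cB cabs_real gtr0_norm ?e_gt0 // ler_pM2l // e_phi.
rewrite -hg0; apply: mean_value_ln => //.
  by rewrite -cabs_gt0 hg0 mulr_gt0 ?phi_gt0.
move=> t; rewrite -cabs_gt0 => gt0.
by rewrite ler_ln ?posrE ?mulr_gt0 ?phi_gt0.
Qed.

(** The inequality for K_n passes to the limit by dominated convergence: on the circle, K_n lies
    between ln a and ln B from a common index on. *)
Lemma green_submean (b1 b2 : C2 R) : basin F b1 ->
  (forall z : C, cabs z <= 1 -> basin F (addC2 b1 (sclC2 z b2))) ->
  ((green b1)%:E <= ((2 * pi)^-1)%:E *
    \int[mu]_(t in `[0%R, (2 * pi)%R]) (green (addC2 b1 (sclC2 (expi t) b2)))%:E)%E.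
Proof.
move=> bb hb; have [n1 n0n1 hn1] := circle_bound hb.
pose c t := addC2 b1 (sclC2 (expi t) b2).
pose f_ k t : \bar R := (K (n1 + k) (c t))%:E.
pose f t : \bar R := (green (c t))%:E.
have intK n : mu.-integrable `[0, 2 * pi] (EFin \o (fun t => K n (c t))).
  rewrite /K; apply: continuous_integrable_segment => t.
  by apply: cvgM; [exact: circle_continuous|exact: cvg_cst].
have cvf t : f_ ^~ t @ \oo --> f t.
  apply: cvg_EFin; first by near=> k.
  have [cv _] := green_cvg n0n1 (hn1 t).
  rewrite -(cvg_shiftn n1) in cv; apply: cvg_trans cv; apply: near_eq_cvg.
  by near=> k; rewrite /= addnC.
have mD : measurable (`[0, 2 * pi] : set R) by exact: measurable_itv.
pose M := `|ln a| + `|ln Bd|.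
have [||||] := @dominated_convergence _ _ R mu `[0, 2 * pi] mD f_ f (cst M%:E)
  (fun k => measurable_int mu (intK (n1 + k)%N)) _ _ _ _.
- apply: (@measurable_realfun.emeasurable_fun_cvg _ _ R _ f_ f) => [k|t _].
    exact: measurable_int (intK (n1 + k)%N).
  exact: cvf.
- by apply: aeW => t _; exact: cvf.
- exact: (continuous_integrable_segment _ _ (fun x => @cst_continuous _ _ M x)).
- apply: aeW => t k _; rewrite /f_ /= lee_fin.
  have h1 := K_ge (n1 + k) (c t).
  have h2 : K (n1 + k) (c t) <= ln Bd.
    apply: K_le; have : nrm (G (n1 + k) (c t)) < 8^-1.
      by apply: (G_lt_mono d2 a01 hF hn0) (hn1 t); rewrite n0n1 leq_addr.
    lra.
  rewrite /M ler_norml; apply/andP; split.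
    have := ler_norm (- ln a); rewrite normrN; have := normr_ge0 (ln Bd); lra.
  by have := ler_norm (ln Bd); have := normr_ge0 (ln a); lra.
move=> _ _ cvint.
have gb n : (n0 <= n)%N -> nrm (G n b1) < 8^-1 -> green b1 <= K n b1.
  by move=> n0n gn; have [] := green_cvg n0n gn.
have pi2 : 0 < 2 * pi :> R by rewrite mulr_gt0 ?pi_gt0.
have /(basinP d2 a01 hF hn0)[n2 n0n2 gn2] := bb.
have low : ((2 * pi * green b1)%:E <= \int[mu]_(t in `[0%R, (2 * pi)%R]) f t)%E.
  apply: cvge_to_ge cvint _; near=> k.
  have intE : (\int[mu]_(t in `[0%R, (2 * pi)%R]) f_ k t)%E =
      (\int[mu]_(t in `[0%R, (2 * pi)%R]) K (n1 + k) (c t))%R%:E.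
    by rewrite /Rintegral fineK //; apply: integrable_fin_num => //; exact: intK.
  rewrite [leRHS]intE lee_fin; apply: le_trans (K_submean _ _ _); rewrite ler_pM2l //.
  apply: gb; first exact: leq_trans n0n1 (leq_addr _ _).
  apply: (G_lt_mono d2 a01 hF hn0) gn2; rewrite n0n2 /=.
  by apply: leq_trans (leq_addl _ _); near: k; exists n2.
have i0 : (0 <= ((2 * pi)^-1 : R)%:E)%E by rewrite lee_fin invr_ge0 ltW.
apply: le_trans (lee_wpmul2l i0 low).
by rewrite -EFinM mulKf // lt0r_neq0.
Unshelve. all: by end_near.
Qed.

End Potential.

(** * The basin is a Short C^2 *)

Lemma connected_increasing_union (R : realType) (W : nat -> set (C2 R)) :
  (forall n, W n `<=` W n.+1) -> (forall n, connectedC2 (W n)) ->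
  connectedC2 (\bigcup_n W n).
Proof.
move=> incr cW A B oA oB sub dis; apply: contrapT => /not_orP[].
have mono m n : (m <= n)%N -> W m `<=` W n.
  by move=> /subnK <-; elim: (n - m)%N => // k IH p /IH; rewrite addSn; exact: incr.
move=> /eqP/set0P[p [[m _ Wp] Ap]] /eqP/set0P[s [[n _ Ws] Bs]].
have Wp' := mono _ _ (leq_maxl m n) _ Wp; have Ws' := mono _ _ (leq_maxr m n) _ Ws.
have [|||] := cW (maxn m n) A B oA oB.
- by move=> x Wx; apply: sub; exists (maxn m n).
- apply/seteqP; split => // x [[Wx Ax] Bx].
  suff : (\bigcup_n W n `&` A `&` B) x by rewrite dis.
  by split => //; split => //; exists (maxn m n).
- by move=> /seteqP[h _]; apply: (h p).
- by move=> /seteqP[h _]; apply: (h s).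
Qed.

Section ShortC2.
Variables (R : realType) (d : nat) (a : R).
Variables (q : nat -> {poly R[i]}) (delta : nat -> R[i]).
Local Notation C := (R[i]).
Hypothesis d2 : (2 <= d)%N.
Hypothesis a01 : 0 < a < 1.
Hypothesis hF : forall n, (1 <= n)%N ->
  [/\ delta n != 0, (size (q n) <= d)%N,
      (forall i, cabs (q n)`_i <= a ^+ (d ^ n)) & cabs (delta n) <= a ^+ (d ^ n)].
Variable n0 : nat.
Hypothesis hn0 : forall n, (n0 <= n)%N -> (d.+2)%:R * a ^+ (d ^ n) <= 64^-1.

Local Notation F := (fun n => Fmap d (q n) (delta n)).
Local Notation G := (compF F).
Local Notation e n := (a ^+ (d ^ n)).
Local Notation Fn n := (Fmap d (q n) (delta n)).
Implicit Types (p v : C2 R) (n : nat).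

Let delta_neq0 n : (1 <= n)%N -> delta n != 0.
Proof. by move=> /hF[]. Qed.

Let GK n : cancel (G n) (Ginv d q delta n).
Proof. by have [] := polyaut_G d q delta_neq0 n. Qed.
Let GinvK n : cancel (Ginv d q delta n) (G n).
Proof. by have [] := polyaut_G d q delta_neq0 n. Qed.

Let Dn0 : 0 < (d ^ n0)%:R :> R.
Proof. by rewrite ltr0n expn_gt0; case: (d) d2. Qed.

(** Test points for non-constancy: at time n0 the orbit of [p1] is at (1/16, 0) and that of [p2] at
    the origin, so [green] times d^n0 is at least ln(1/32) at the former and at most ln(1/64) at the
    latter. *)
Let p1 := Ginv d q delta n0 (((16^-1 : R)%:C)%C, 0).
Let p2 := Ginv d q delta n0 (zeroC2 R).

Let Gp1 : nrm (G n0 p1) < 8^-1.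
Proof.
by rewrite GinvK; apply/nrm_lt; rewrite /= cabs0 cabs_real gtr0_norm ?invr_gt0 //; split; lra.
Qed.

Let Gp2 : nrm (G n0 p2) < 8^-1.
Proof. by rewrite GinvK; apply/nrm_lt; rewrite /= cabs0; split; lra. Qed.

Lemma green_p2 : green d a q delta p2 <= ln (64^-1) / (d ^ n0)%:R.
Proof.
have [_ h] := green_cvg d2 a01 hF hn0 (leqnn n0) Gp2; apply: (le_trans h).
have -> : K d a q delta n0 p2 = ln (d.+2%:R * e n0) / (d ^ n0)%:R.
  congr (ln (_ * _) / _); rewrite /phi GinvK; apply/max_idPr.
  by apply/nrm_le; rewrite /= cabs0; split; exact: ltW (e_gt0 _ a01 _).
rewrite ler_pM2r ?invr_gt0 // ler_ln ?posrE ?invr_gt0 ?mulr_gt0 ?(e_gt0 _ a01 _) //.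
exact: hn0.
Qed.

(* along this orbit the term z^d dominates, so the first coordinate decays no
   faster than 2 (1/32)^(d^k) *)
Lemma orbit_p1_ge k : 2 * (32^-1) ^+ (d ^ k) <= cabs (G (n0 + k) p1).1.
Proof.
elim: k => [|k IH].
  by rewrite addn0 GinvK /= cabs_real expn0 expr1 gtr0_norm ?invr_gt0 //; lra.
rewrite addnS /=; set m := (n0 + k)%N in IH *.
have n0m : (n0 <= m)%N by exact: leq_addr.
have gm : nrm (G m p1) < 8^-1 by apply: (G_lt_mono d2 a01 hF hn0) Gp1; rewrite leqnn.
have z1 := nrm_fst (G m p1); have w1 := nrm_snd (G m p1).
have [_ _ _ hd] := hF (ltn0Sn m).
have b1 : cabs ((q m.+1).[(G m p1).1]) <= d%:R * e m.+1.
  by apply: (q_bound hF) => //; lra.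
have b2 : cabs (delta m.+1 * (G m p1).2) <= 1 * e m.+1.
  by rewrite cabsM mul1r -[leRHS]mulr1; apply: ler_pM; rewrite ?cabs_ge0 //; lra.
have tri (x y z : C) : cabs x <= cabs (x + y + z) + (cabs y + cabs z).
  have := cabsD (x + y + z) (- (y + z)); have := cabsD y z; rewrite cabsN.
  have -> : x + y + z - (y + z) = x by ring.
  lra.
have := tri ((G m p1).1 ^+ d) (q m.+1).[(G m p1).1] (delta m.+1 * (G m p1).2).
rewrite cabsX; set y := 32^-1 ^+ (d ^ k.+1).
have y0 : 0 < y by rewrite exprn_gt0 // invr_gt0.
(* The factor 2 of the induction hypothesis becomes 2^d >= 4, while the error terms cost at most one
   y, so at least 2 y remains. *)
have : 4 * y <= cabs (G m p1).1 ^+ d.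
  apply: (@le_trans _ _ ((2 * 32^-1 ^+ (d ^ k)) ^+ d)).
    rewrite exprMn -exprM -expnSr -/y ler_wpM2r ?(ltW y0) //.
    have -> : 4 = 2 ^+ 2 :> R by ring.
    by apply: ler_weXn2l => //; rewrite ler1n.
  by rewrite lerXn2r ?nnegrE ?cabs_ge0 // mulr_ge0 // exprn_ge0 // invr_ge0.
(* The error e_(m+1) is the d^(k+1)-th power of e_n0, and (d+1) e_n0 <= 1/32. *)
have : d.+1%:R * e m.+1 <= y.
  have -> : e m.+1 = e n0 ^+ (d ^ k.+1) by rewrite -exprM -expnD addnS.
  have dk : (0 < d ^ k.+1)%N by rewrite expn_gt0; case: (d) d2.
  apply: (@le_trans _ _ ((d.+1%:R * e n0) ^+ (d ^ k.+1))).
    have a0 : 0 <= a by case/andP: a01 => /ltW.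
    by rewrite exprMn ler_wpM2r ?exprn_ge0 // ler_eXnr // ler1n.
  have := dSe_le hn0 (leqnn n0); have := e_gt0 d a01 n0 => e0 h.
  rewrite lerXn2r ?nnegrE ?mulr_ge0 ?(ltW e0) //; lra.
rewrite -natr1 mulrDl; lra.
Qed.

Lemma green_p1 : ln (32^-1) / (d ^ n0)%:R <= green d a q delta p1.
Proof.
have [cv _] := green_cvg d2 a01 hF hn0 (leqnn n0) Gp1.
rewrite /green; apply: limr_ge; first exact: cvgP cv.
exists n0 => // m /= n0m.
have -> : m = (n0 + (m - n0))%N by lia.
set k := (m - n0)%N.
have dk : 0 < (d ^ k)%:R :> R by rewrite ltr0n expn_gt0; case: (d) d2.
rewrite /K expnD natrM invfM [(d ^ n0)%:R^-1 * _]mulrC mulrA ler_pM2r ?invr_gt0 //.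
rewrite ler_pdivlMr // mulr_natr -lnXn ?invr_gt0 //.
have y0 : 0 < 32^-1 ^+ (d ^ k) :> R by rewrite exprn_gt0 // invr_gt0.
rewrite ler_ln ?posrE ?mulr_gt0 ?(phi_gt0 _ _ _ a01) //.
have := orbit_p1_ge k; have := nrm_fst (G (n0 + k) p1) => h1 h2.
have h3 : nrm (G (n0 + k) p1) <= phi d a q delta (n0 + k) p1 by rewrite le_max lexx.
have : 1 * phi d a q delta (n0 + k) p1 <= d.+2%:R * phi d a q delta (n0 + k) p1.
  by rewrite ler_wpM2r ?ler1n // ltW // (phi_gt0 _ _ _ a01).
lra.
Qed.

Lemma green_nonconstant : exists x y, basin F x /\ basin F y /\
  (green d a q delta x)%:E <> (green d a q delta y)%:E.
Proof.
exists p1, p2; do 2 (split; first by apply/(basinP d2 a01 hF hn0); exists n0).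
move=> [h]; have := le_trans green_p1 (le_trans _ green_p2).
rewrite h => /(_ (lexx _)); rewrite ler_pM2r ?invr_gt0 // ler_ln ?posrE ?invr_gt0 //; lra.
Qed.

Lemma ball_exhaustion_domain n :
  domainC2 [set p | normC2 (G n p) < 8^-1] /\
  biholomorphicC2 [set p | normC2 (G n p) < 8^-1] (@unit_ball R).
Proof.
have c0 : ((8 : R)%:C)%C != 0 :> C by rewrite -cabs_gt0 cabs_real gtr0_norm.
have aut := polyaut_autC2 (polyaut_comp (polyaut_G d q delta_neq0 n) (polyaut_scale c0)).
have -> : [set p | normC2 (G n p) < 8^-1] = (scale (8 : R)%:C%C \o G n) @^-1` (@unit_ball R).
  have nS (p : C2 R) : normC2 (scale (8 : R)%:C%C p) = 8 * normC2 p.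
    rewrite /normC2 /= !cabsM !cabs_real !exprMn -mulrDr sqrtrM ?sqr_ge0 //.
    by rewrite sqrtr_sqr normr_id gtr0_norm.
  by apply/seteqP; split=> p; rewrite /unit_ball /preimage /mkset /comp nS; lra.
split; last exact: (aut_biholomorphic aut).
exact/(aut_domain aut)/domain_ball.
Qed.

(** The spare e_(n+1) in the threshold pays for the second coordinate: the new Euclidean norm is at
    most r^2 + (d+2) e_(n+1) <= 1/64 + 1/64, with r the old sup norm. *)
Lemma ball_exhaustion_step n p : (n0 <= n)%N ->
  normC2 (G n p) < 8^-1 -> normC2 (G n.+1 p) < 8^-1.
Proof.
move=> n0n h; have h1 := nrm_normC2 (G n p); have h0 := nrm_ge0 (G n p).
have r1 : nrm (G n p) <= 1 by lra.
apply: le_lt_trans (normC2_leD _) _.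
have := F_fst_le hF (ltn0Sn n) (lexx _) r1; have := F_snd_le hF (ltn0Sn n) (lexx (nrm (G n p))).
have := dSe_le hn0 (leqW n0n); have e0 := e_gt0 d a01 n.+1.
have := exp_d_le d2 (_ : 0 <= nrm (G n p) <= 1); rewrite h0 r1 => /(_ isT).
have : e n.+1 * nrm (G n p) <= e n.+1 * 1 by rewrite ler_wpM2l // ltW.
rewrite /=; nra.
Qed.

Lemma basin_ball_exhaustion :
  basin F = \bigcup_n [set p | normC2 (G (n0 + n) p) < 8^-1].
Proof.
apply/seteqP; split => p.
  move=> bp; have [|N n0N hN] := basin_small n0 bp (_ : 0 < 16^-1); first lra.
  exists (N - n0)%N => //=; rewrite subnKC //.
  apply: le_lt_trans (normC2_nrm _) _; have := hN N (leqnn N); lra.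
move=> [n _ /= h]; apply/(basinP d2 a01 hF hn0); exists (n0 + n)%N; first exact: leq_addr.
exact: le_lt_trans (nrm_normC2 _) h.
Qed.

Lemma basin_domain : domainC2 (basin F).
Proof.
split; first by exists p2; apply/(basinP d2 a01 hF hn0); exists n0.
rewrite basin_ball_exhaustion; split.
  move=> p [n _ /= h].
  have [[_ [oW _]] _] := ball_exhaustion_domain (n0 + n).
  by have [r r0 hr] := oW p h; exists r => // s sp; exists n => //; exact: hr.
apply: connected_increasing_union => n.
  by move=> p /=; rewrite addnS; apply: ball_exhaustion_step; exact: leq_addr.
by have [[_ [_ ]]] := ball_exhaustion_domain (n0 + n).
Qed.

Lemma basin_short : shortC2 (basin F).
Proof.
split; first exact: basin_domain.
- exists (fun n => [set p | normC2 (G (n0 + n) p) < 8^-1]); split.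
  + by move=> n p /=; rewrite addnS; apply: ball_exhaustion_step; exact: leq_addr.
  + exact: basin_ball_exhaustion.
  + by move=> n; exact: ball_exhaustion_domain.
- by move=> p v; exact: (kobayashi_basin d2 a01 hF hn0).
exists (fun p => (green d a q delta p)%:E); split.
- split=> [p _|p c bp|b1 b2 bb hb]; first exact: ltry.
    rewrite lte_fin => /(green_usc d2 a01 hF hn0 bp)[r r0 hr].
    by exists r => // s bs sp; rewrite lte_fin; exact: hr.
  exact: (green_submean d2 a01 hF hn0).
- by exists (ln d.+2%:R) => p bp; rewrite lee_fin; exact: (green_le d2 a01 hF hn0).
- exact: green_nonconstant.
Qed.

End ShortC2.

(** * The Loewner chain *)

Section LoewnerChain.
Variables (R : realType) (d : nat) (a : R).
Variables (q : nat -> {poly R[i]}) (delta : nat -> R[i]).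
Local Notation C := (R[i]).
Hypothesis d2 : (2 <= d)%N.
Hypothesis a01 : 0 < a < 1.
Hypothesis hF : forall n, (1 <= n)%N ->
  [/\ delta n != 0, (size (q n) <= d)%N,
      (forall i, cabs (q n)`_i <= a ^+ (d ^ n)) & cabs (delta n) <= a ^+ (d ^ n)].
Variable n0 : nat.
Hypothesis hn0 : forall n, (n0 <= n)%N -> (d.+2)%:R * a ^+ (d ^ n) <= 64^-1.

Local Notation F := (fun n => Fmap d (q n) (delta n)).
Local Notation G := (compF F).
Local Notation e n := (a ^+ (d ^ n)).
Local Notation Fn n := (Fmap d (q n) (delta n)).
Implicit Types (p v : C2 R) (n : nat).

Let delta_neq0 n : (1 <= n)%N -> delta n != 0.
Proof. by move=> /hF[]. Qed.

Let D n := cabs (delta n.+1).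

Let D_gt0 n : 0 < D n.
Proof. by rewrite cabs_gt0 delta_neq0. Qed.

Let D_le n : (n0 <= n)%N -> D n <= 256^-1.
Proof.
move=> n0n; have [_ _ _ h] := hF (ltn0Sn n).
have := e_le d2 a01 hn0 (leqW n0n); rewrite /D; lra.
Qed.

(** The clocks of the two halves of a stage: [cpar] runs from 0 to 1 on [0, 1/2] and [bpar] on
    [1/2, 1]. *)
Definition cpar (x : R) := Num.min (2 * x) 1.
Definition bpar (x : R) := Num.max (2 * x - 1) 0.

Lemma par_le x : x <= 2^-1 -> cpar x = 2 * x /\ bpar x = 0.
Proof. by move=> h; rewrite /cpar /bpar; split; [apply/min_idPl|apply/max_idPr]; lra. Qed.

Lemma par_ge x : 2^-1 <= x -> cpar x = 1 /\ bpar x = 2 * x - 1.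
Proof. by move=> h; rewrite /cpar /bpar; split; [apply/min_idPr|apply/max_idPl]; lra. Qed.

(* For 0 <= x <= 1/2 the centre of the fibre over z moves from 0 to that of
   F_{n+1}^-1 of a polydisc; for 1/2 <= x <= 1 only the radii grow. *)
Definition radius1 n (x : R) := (1 + cpar x) / 8 + bpar x * ((8 * D n)^-1 - 4^-1).
(** In the first half this radius must outgrow the motion of the centre: its slope 3/32 - D/8 in c
    beats the bound 5/64 of [zdq_le], since D <= 1/256. *)
Definition radius2 n (x : R) := D n / 8 + cpar x * (3 / 32 - D n / 8) + bpar x / 32.

Definition zdq n (z : C) := z ^+ d + (q n.+1).[z].

Definition fibre n (x : R) (p : C2 R) := delta n.+1 * p.2 + (cpar x)%:C%C * zdq n p.1.

(** A single defining function for the domain and its closure, so that the axioms of the chain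
    become inequalities in x. *)
Definition gauge n (x : R) (p : C2 R) : R :=
  Num.max (cabs (G n p).1 - radius1 n x) (cabs (fibre n x (G n p)) - radius2 n x).

Definition V n x := [set p : C2 R | gauge n x p < 0].
Definition Vc n x := [set p : C2 R | gauge n x p <= 0].

Lemma gauge_lt0 n x p : gauge n x p < 0 <->
  cabs (G n p).1 < radius1 n x /\ cabs (fibre n x (G n p)) < radius2 n x.
Proof. by rewrite /gauge gt_max !subr_lt0; split => /andP. Qed.

Lemma gauge_le0 n x p : gauge n x p <= 0 <->
  cabs (G n p).1 <= radius1 n x /\ cabs (fibre n x (G n p)) <= radius2 n x.
Proof. by rewrite /gauge ge_max !subr_le0; split => /andP. Qed.

Let L_gt n : (n0 <= n)%N -> 4^-1 < (8 * D n)^-1.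
Proof.
move=> n0n; have h := D_le n0n; have h0 := D_gt0 n.
have l4 : 8 * D n < 4 by lra.
by rewrite ltf_pV2 ?posrE ?mulr_gt0.
Qed.

Lemma radius1_gt0 n x : (n0 <= n)%N -> 0 <= x -> 0 < radius1 n x.
Proof.
move=> /L_gt h x0; rewrite /radius1.
have [x2|/ltW x2] := leP x 2^-1; first by have [-> ->] := par_le x2; lra.
have [-> ->] := par_ge x2.
have : 0 <= (2 * x - 1) * ((8 * D n)^-1 - 4^-1) by rewrite mulr_ge0 //; lra.
lra.
Qed.

Lemma radius2_gt0 n x : (n0 <= n)%N -> 0 <= x -> 0 < radius2 n x.
Proof.
move=> /D_le h x0; have h0 := D_gt0 n; rewrite /radius2.
have [x2|/ltW x2] := leP x 2^-1; last by have [-> ->] := par_ge x2; lra.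
have [-> ->] := par_le x2.
have : 0 <= 2 * x * (3 / 32 - D n / 8) by rewrite mulr_ge0 //; lra.
lra.
Qed.

Lemma zdq_le n z : (n0 <= n)%N -> cabs z <= 4^-1 -> cabs (zdq n z) <= 5 / 64.
Proof.
move=> n0n z4; have q1 : (4^-1 : R) <= 1 by lra.
apply: (le_trans (zdq_bound hF (ltn0Sn n) z4 q1)); have := dSe_le hn0 (leqW n0n).
have e0 := e_gt0 d a01 n.+1.
have : 4^-1 ^+ d <= (4^-1 : R) ^+ 2 by apply: (exp_d_le d2); apply/andP; split; lra.
rewrite -[d.+1%:R]natr1 mulrDl mul1r expr2; lra.
Qed.

(** While the fibre centre moves, the second radius grows strictly faster and |z| <= 1/4 holds;
    afterwards the centre is fixed and both radii grow. *)
Lemma gauge_gap n x y p : (n0 <= n)%N -> 0 <= x -> x < y ->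
  gauge n x p <= 0 -> gauge n y p < 0.
Proof.
move=> n0n x0 xy /gauge_le0[h1 h2]; apply/gauge_lt0.
have L0 := L_gt n0n; have Dl := D_le n0n; have D0 := D_gt0 n.
have tri : cabs (fibre n y (G n p)) <=
    cabs (fibre n x (G n p)) + `|cpar y - cpar x| * cabs (zdq n (G n p).1).
  have -> : fibre n y (G n p) =
      fibre n x (G n p) + (cpar y - cpar x)%:C%C * zdq n (G n p).1.
    by rewrite /fibre rmorphB; ring.
  by apply: le_trans (cabsD _ _) _; rewrite cabsM cabs_real.
have [x2|x2] := leP 2^-1 x.
  have y2 : 2^-1 <= y by lra.
  move: h1 h2 tri; rewrite /radius1 /radius2.
  have [-> ->] := par_ge x2; have [-> ->] := par_ge y2.
  rewrite subrr normr0 mul0r addr0 => h1 h2 tri.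
  by split; nra.
have x2' := ltW x2; have [cx bx] := par_le x2'.
have z4 : cabs (G n p).1 <= 4^-1 by move: h1; rewrite /radius1 cx bx; lra.
have H := zdq_le n0n z4; have H0 := cabs_ge0 (zdq n (G n p).1).
have [y2|/ltW y2] := leP y 2^-1.
  have [cy by0] := par_le y2.
  move: h1 h2 tri; rewrite /radius1 /radius2 cx bx cy by0 ger0_norm; last by lra.
  by move=> h1 h2 tri; split; nra.
have [cy by0] := par_ge y2.
move: h1 h2 tri; rewrite /radius1 /radius2 cx bx cy by0 ger0_norm; last by lra.
move=> h1 h2 tri.
have w1 : 0 <= (2 * y - 1) * ((8 * D n)^-1 - 4^-1) by rewrite mulr_ge0 //; lra.
(* When x < 1/2 < y, the rest of the first half already gives a strict gain in the second radius. *)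
have w2 : 0 < (1 - 2 * x) * (3 / 32 - D n / 8 - cabs (zdq n (G n p).1)).
  by rewrite mulr_gt0 //; lra.
by split; lra.
Qed.

(** The constant may depend on p: continuity in x at fixed p is what [V_left] and [Vc_right] use for
    the two one-sided limits of the chain. *)
Lemma gauge_lipschitz n p : exists2 B : R, 0 < B &
  forall x y, gauge n y p <= gauge n x p + B * `|x - y|.
Proof.
set H := cabs (zdq n (G n p).1).
have H0 : 0 <= H by exact: cabs_ge0.
set A1 := `|(8 * D n)^-1 - 4^-1|; set A2 := `|3 / 32 - D n / 8|.
have A10 : 0 <= A1 by exact: normr_ge0.
have A20 : 0 <= A2 by exact: normr_ge0.
exists (2 * H + 2 * A1 + 2 * A2 + 1); first lra.
move=> x y; set h := `|x - y|.
have h1 : x - y <= h by exact: ler_norm.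
have h2 : y - x <= h by rewrite /h distrC; exact: ler_norm.
have h0 : 0 <= h by exact: normr_ge0.
have dc : `|cpar y - cpar x| <= 2 * h.
  by rewrite ler_norml /cpar; apply/andP; case: (leP (2 * y) 1) => ?;
    case: (leP (2 * x) 1) => ?; split; lra.
have db : `|bpar y - bpar x| <= 2 * h.
  by rewrite ler_norml /bpar; apply/andP; case: (leP (2 * y - 1) 0) => ?;
    case: (leP (2 * x - 1) 0) => ?; split; lra.
have tri : cabs (fibre n y (G n p)) <= cabs (fibre n x (G n p)) + 2 * h * H.
  have -> : fibre n y (G n p) =
      fibre n x (G n p) + (cpar y - cpar x)%:C%C * zdq n (G n p).1.
    by rewrite /fibre rmorphB; ring.
  by apply: le_trans (cabsD _ _) _; rewrite lerD2l cabsM cabs_real ler_wpM2r.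
have m1 : `|(bpar y - bpar x) * ((8 * D n)^-1 - 4^-1)| <= 2 * h * A1.
  by rewrite normrM ler_wpM2r.
have m2 : `|(cpar y - cpar x) * (3 / 32 - D n / 8)| <= 2 * h * A2.
  by rewrite normrM ler_wpM2r.
move: dc db m1 m2; rewrite !ler_norml => /andP[c1 c2] /andP[b1 b2] /andP[m1 m1'] /andP[m2 m2'].
have g1 : cabs (G n p).1 - radius1 n x <= gauge n x p by rewrite le_max lexx.
have g2 : cabs (fibre n x (G n p)) - radius2 n x <= gauge n x p by rewrite le_max lexx orbT.
have p1 := mulr_ge0 h0 H0; have p2 := mulr_ge0 h0 A10; have p3 := mulr_ge0 h0 A20.
rewrite {1}/gauge ge_max; apply/andP; split; move: g1 g2; rewrite /radius1 /radius2; nra.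
Qed.

Lemma V_left n x p : 0 < x -> V n x p -> exists2 y, 0 <= y < x & V n y p.
Proof.
move=> x0 Vp; have [B B0 hB] := gauge_lipschitz n p.
rewrite /V /= in Vp; set g := gauge n x p in Vp.
(* With 2 B t <= - g, moving back by t raises the gauge by at most half of its distance to 0. *)
set t := Num.min x (- g / (2 * B)).
have t0 : 0 < t by rewrite lt_min x0 divr_gt0 ?mulr_gt0 // oppr_gt0.
have tx : t <= x by rewrite ge_min lexx.
have tg : t <= - g / (2 * B) by rewrite ge_min lexx orbT.
exists (x - t); first by apply/andP; split; lra.
rewrite /V /=; apply: le_lt_trans (hB x (x - t)) _; rewrite -/g.
have -> : x - (x - t) = t by ring.
rewrite gtr0_norm //; move: tg; rewrite ler_pdivlMr ?mulr_gt0 //; lra.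
Qed.

Lemma Vc_right n x p : x < 1 -> (forall y, x < y < 1 -> V n y p) -> Vc n x p.
Proof.
move=> x1 hV; have [B B0 hB] := gauge_lipschitz n p.
rewrite /Vc /=; apply/ler_addgt0Pr => c c0; rewrite add0r.
set t := Num.min ((1 - x) / 2) (c / B).
have t0 : 0 < t by rewrite lt_min !divr_gt0 // subr_gt0.
have t1 : t <= (1 - x) / 2 by rewrite ge_min lexx.
have t2 : t <= c / B by rewrite ge_min lexx orbT.
have := hV (x + t); rewrite /V /= => /(_ _); have xt : x < x + t < 1 by apply/andP; split; lra.
move=> /(_ xt) h; apply: le_trans (hB (x + t) x) _.
have -> : x + t - x = t by ring.
rewrite gtr0_norm //; move: t2; rewrite ler_pdivlMr //; lra.
Qed.

Lemma V0 n : V n 0 = [set p | nrm (G n p) < 8^-1].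
Proof.
have h0 : (0 : R) <= 2^-1 by rewrite invr_ge0.
have [c0 b0] := par_le h0.
have e1 : radius1 n 0 = 8^-1 by rewrite /radius1 c0 b0; lra.
have e2 : radius2 n 0 = D n / 8 by rewrite /radius2 c0 b0; lra.
have e3 p : cabs (fibre n 0 p) = D n * cabs p.2.
  by rewrite /fibre c0 mulr0 mul0r addr0 cabsM.
apply/seteqP; split => p.
  by move=> /gauge_lt0; rewrite e1 e2 e3 ltr_pM2l // => h; apply/nrm_lt.
by move=> /nrm_lt h; apply/gauge_lt0; rewrite e1 e2 e3 ltr_pM2l.
Qed.

(** Together with [V0] this glues the stages: stage n ends where stage n + 1 begins. *)
Lemma V1 n : V n 1 = [set p | nrm (G n.+1 p) < 8^-1].
Proof.
have [|c1 b1] := @par_ge 1; first lra.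
have D0 := D_gt0 n.
have e1 : radius1 n 1 = (8 * D n)^-1 by rewrite /radius1 c1 b1; lra.
have e2 : radius2 n 1 = 8^-1 by rewrite /radius2 c1 b1; lra.
have e3 p : fibre n 1 p = (Fn n.+1 p).1.
  by rewrite /fibre c1 mul1r /zdq /Fmap /= addrC.
have e4 p : (cabs p.1 < (8 * D n)^-1) = (cabs (Fn n.+1 p).2 < 8^-1).
  by rewrite /Fmap /= cabsM invfM -ltr_pdivrMr ?invr_gt0 // invrK mulrC.
apply/seteqP; split => p.
  by move=> /gauge_lt0; rewrite e1 e2 e3 e4 => -[h1 h2]; apply/nrm_lt.
by move=> /nrm_lt[h1 h2]; apply/gauge_lt0; rewrite e1 e2 e3 e4.
Qed.

Lemma V_polydisc n x : (n0 <= n)%N -> 0 <= x ->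
  exists A B, [/\ autC2 A B, V n x = A @^-1` (@unit_polydisc R) &
                  Vc n x = A @^-1` (@closed_polydisc R)].
Proof.
move=> n0n x0; have r1 := radius1_gt0 n0n x0; have r2 := radius2_gt0 n0n x0.
have nz (r : R) : 0 < r -> r%:C%C != 0 by move=> r0; rewrite -cabs_gt0 cabs_real normr_gt0 lt0r_neq0.
have := polyaut_shear d (q n.+1) (cpar x)%:C%C (delta_neq0 (ltn0Sn n)) (nz _ r1) (nz _ r2).
move=> /(polyaut_comp (polyaut_G d q delta_neq0 n))/polyaut_autC2 aut.
have cV (r : R) (z : C) : 0 < r -> cabs (r%:C%C^-1 * z) = cabs z / r.
  by move=> r0; rewrite cabsM cabsV cabs_real gtr0_norm // mulrC.
eexists; eexists; split; first exact: aut.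
  apply/seteqP; split => p.
    by move=> /gauge_lt0[h1 h2]; split; rewrite /= cV // ltr_pdivrMr // mul1r.
  move=> [] /=; rewrite !cV // !ltr_pdivrMr // !mul1r => h1 h2.
  exact/gauge_lt0.
apply/seteqP; split => p.
  by move=> /gauge_le0[h1 h2]; split; rewrite /= cV // ler_pdivrMr // mul1r.
move=> [] /=; rewrite !cV // !ler_pdivrMr // !mul1r => h1 h2.
exact/gauge_le0.
Qed.

Lemma V_closure n x : (n0 <= n)%N -> 0 <= x -> closureC2 (V n x) = Vc n x.
Proof.
by move=> h1 h2; have [A [B [aut -> ->]]] := V_polydisc h1 h2;
  rewrite (aut_closure aut) closure_polydisc.
Qed.

Lemma V_mono n x y : (n0 <= n)%N -> 0 <= x -> x <= y -> V n x `<=` V n y.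
Proof.
move=> n0n x0; rewrite le_eqVlt => /orP[/eqP <- //|xy] p /ltW.
exact: gauge_gap.
Qed.

Definition chain (t : R) := V (n0 + Num.truncn t) (t - (Num.truncn t)%:R).

Let trunc_itv (t : R) : 0 <= t -> 0 <= t - (Num.truncn t)%:R < 1.
Proof.
move=> /truncn_itv /andP[h1 h2]; rewrite subr_ge0 h1 /= ltrBlDr addrC natr1 //.
Qed.

Let chain_nat (k : nat) (x : R) : 0 <= x < 1 -> chain (k%:R + x) = V (n0 + k) x.
Proof.
move=> /andP[x0 x1]; rewrite /chain; have -> : Num.truncn (k%:R + x) = k.
  by apply/truncn_def; rewrite lerDl x0 -natr1 ltrD2l.
by congr V; rewrite [_ + x]addrC addrK.
Qed.

(** Starting from the closed set yields monotonicity, relative compactness and one inclusion of the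
    intersection axiom together. *)
Lemma chain_lt (t s : R) : 0 <= t -> t < s ->
  Vc (n0 + Num.truncn t) (t - (Num.truncn t)%:R) `<=` chain s.
Proof.
move=> t0 ts p; have s0 : 0 <= s by lra.
have /andP[x0 x1] := trunc_itv t0; have /andP[y0 y1] := trunc_itv s0.
rewrite /chain; set k := Num.truncn t in x0 x1 *; set l := Num.truncn s in y0 y1 *.
have kl : (k <= l)%N by apply: le_truncn; exact: ltW.
have n0k m : (n0 <= n0 + m)%N by exact: leq_addr.
move: kl; rewrite leq_eqVlt => /orP[/eqP kl|kl].
  by move=> h; rewrite -kl; apply: (gauge_gap (n0k k) x0 _ h); lra.
(* If s lies in a later stage, pass to the end of the current one, which is a trapped polydisc, and
   then follow forward invariance. *)
move=> /(gauge_gap (n0k k) x0 x1) h.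
have {}h : nrm (G (n0 + k).+1 p) < 8^-1 by have : V (n0 + k) 1 p := h; rewrite V1.
apply: (@V_mono _ 0) => //; rewrite V0 /=; apply: (G_lt_mono d2 a01 hF hn0) h.
by rewrite -addnS n0k leq_add2l.
Qed.

Lemma basin_loewner_chain : exists W : R -> set (C2 R),
  (forall t, 0 <= t -> domainC2 (W t)) /\
  [/\ basin F = \bigcup_(t in [set t : R | 0 <= t]) W t,
      ((forall t, 0 <= t -> biholomorphicC2 (W t) (@unit_ball R)) \/
       (forall t, 0 <= t -> biholomorphicC2 (W t) (@unit_polydisc R))),
      (forall t s, 0 <= t -> t < s -> relcompactC2 (W t) (W s)),
      (forall t, 0 < t -> W t = \bigcup_(t' in [set t' : R | 0 <= t' < t]) W t') &
      (forall t', 0 <= t' -> closureC2 (W t') = \bigcap_(t in [set t : R | t' < t]) W t)].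
Proof.
have n0k m : (n0 <= n0 + m)%N by exact: leq_addr.
have aut (t : R) : 0 <= t -> exists A B, [/\ autC2 A B, chain t = A @^-1` (@unit_polydisc R) &
    Vc (n0 + Num.truncn t) (t - (Num.truncn t)%:R) = A @^-1` (@closed_polydisc R)].
  by move=> t0; have /andP[x0 _] := trunc_itv t0; exact: V_polydisc.
have cl (t : R) : 0 <= t -> closureC2 (chain t) = Vc (n0 + Num.truncn t) (t - (Num.truncn t)%:R).
  by move=> t0; have /andP[x0 _] := trunc_itv t0; exact: V_closure.
have mono (t s : R) : 0 <= t -> t < s -> chain t `<=` chain s.
  by move=> t0 ts p /ltW h; apply: chain_lt h.
exists chain; split; last split.
- move=> t t0; have [A [B [ab -> _]]] := aut t t0.
  exact/(aut_domain ab)/domain_polydisc.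
- apply/seteqP; split => p.
    move=> /(basinP d2 a01 hF hn0)[n n0n gn]; exists ((n - n0)%:R + 0) => /=.
      by rewrite addr0.
    by rewrite chain_nat ?lexx ?ltr01 // subnKC // V0.
  move=> [t /= t0 ht]; apply/(basinP d2 a01 hF hn0).
  have /andP[x0 x1] := trunc_itv t0.
  exists (n0 + Num.truncn t).+1; first exact: leqW.
  by have := V_mono (n0k _) x0 (ltW x1) ht; rewrite V1.
- right=> t t0; have [A [B [ab -> _]]] := aut t t0; exact: (aut_biholomorphic ab).
- move=> t s t0 ts; split; rewrite cl //; last exact: chain_lt.
  have [A [B [ab _ ->]]] := aut t t0.
  exact/(aut_compact ab)/compact_closed_polydisc.
- move=> t t0; apply/seteqP; split => p; last first.
    by move=> [s /andP[s0 st]]; exact: mono.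
  have /andP[x0 x1] := trunc_itv (ltW t0).
  (* At an integer time k the domain must be reached from the left, so it is rewritten as the end of
     stage k - 1. *)
  set k := Num.truncn t in x0 x1; move: x0; rewrite le_eqVlt => /orP[/eqP x0|x0].
    have {}x0 : t = k%:R by lra.
    have k0 : (0 < k)%N by rewrite -(ltr0n R) -x0.
    rewrite {1}x0 -[k%:R]addr0 chain_nat ?lexx ?ltr01 // V0 -(prednK k0) addnS -V1.
    move=> /(V_left ltr01)[y /andP[y0 y1] Vy].
    exists (k.-1%:R + y); last by rewrite chain_nat // y0.
    by rewrite /= addr_ge0 //= x0 -{2}(prednK k0) -natr1 ltrD2l.
  rewrite {1}/chain -/k => /(V_left x0)[y /andP[y0 y1] Vy].
  exists (k%:R + y); first by rewrite /= addr_ge0 //= -ltrBrDl.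
  by rewrite chain_nat // y0 (lt_trans y1).
- move=> t t0; rewrite cl //; apply/seteqP; split => p.
    by move=> h s /= ts; apply: chain_lt h.
  move=> h; have /andP[x0 x1] := trunc_itv t0; apply: Vc_right => // y /andP[xy y1].
  have := h ((Num.truncn t)%:R + y); rewrite chain_nat; first by apply; rewrite /= -ltrBlDl.
  by rewrite y1 andbT; lra.
Qed.

End LoewnerChain.

Theorem theorem1p4 (R : realType) (d : nat) (a : nat -> R)
    (q : nat -> {poly R[i]}) (delta : nat -> R[i]) :
  (2 <= d)%N ->
  (forall n, (1 <= n)%N -> 0 < a n.+1 /\ a n.+1 <= a n /\ a n < 1) ->
  (forall n, (1 <= n)%N ->
     [/\ delta n != 0,
         (2 <= size (q n) <= d)%N,
         (forall i, cabs (q n)`_i <= a n ^+ (d ^ n)) &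
         cabs (delta n) <= a n ^+ (d ^ n)]) ->
  loewner_shortC2 (basin (fun n => Fmap d (q n) (delta n))).
Proof.
move=> d2 ha hq.
have a01 : 0 < a 1%N < 1.
  by have [h1 [h2 ->]] := ha 1%N isT; rewrite (lt_le_trans h1 h2).
(* Monotonicity replaces every a_n by a_1, the constant a of the preceding sections. *)
have a_le n : (1 <= n)%N -> 0 <= a n <= a 1%N.
  elim: n => // -[_ _|n IH _]; first by rewrite lexx andbT ltW //; case/andP: a01.
  have [h1 [h2 _]] := ha n.+1 isT; have /andP[_ h3] := IH isT.
  by rewrite (ltW h1) (le_trans h2).
have e_le n : (1 <= n)%N -> a n ^+ (d ^ n) <= a 1%N ^+ (d ^ n).
  move=> /a_le/andP[h1 h2].
  by rewrite lerXn2r ?nnegrE // (le_trans h1).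
have hF n : (1 <= n)%N -> [/\ delta n != 0, (size (q n) <= d)%N,
    (forall i, cabs (q n)`_i <= a 1%N ^+ (d ^ n)) & cabs (delta n) <= a 1%N ^+ (d ^ n)].
  move=> n1; have [h1 /andP[_ h2] h3 h4] := hq n n1; have h := e_le n n1.
  by split => // [i|]; [exact: le_trans (h3 i) h|exact: le_trans h4 h].
have c0 : 0 < (d.+2%:R * 64)^-1 :> R by rewrite invr_gt0 mulr_gt0.
have [n0 h] := e_small d2 a01 c0.
have hn0 n : (n0 <= n)%N -> d.+2%:R * a 1%N ^+ (d ^ n) <= 64^-1.
  by move=> /h/ltW h1; rewrite mulrC -ler_pdivlMr // -invfM [64 * _]mulrC.
split; first exact: (basin_short d2 a01 hF hn0).
exact: (basin_loewner_chain d2 a01 hF hn0).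
Qed.
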